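(* The metric space $(\mathcal{M},\mathcal{W}^{a,b}_p)$ is complete.
   Context: Setting. $\mathcal{X}$ is a finite set with $N$ points, $K:\mathcal{X}\times\mathcal{X}\to[0,\infty)$ is an irreducible Markov kernel (row-stochastic matrix), and $\varpi:\mathcal{X}\to[0,\infty)$ is its unique steady-state probability distribution ($\varpi(x)=\sum_{y}\varpi(y)K(y,x)$, $\sum_y\varpi(y)=1$). $\varpi$ is assumed reversible: $K(x,y)\varpi(x)=K(y,x)\varpi(y)$ for all $x,y$. $\mathcal{M}=\{\mu:\mathcal{X}\to\mathbb{R}\mid \mu(x)\ge 0\ \forall x\}$ and $\mathcal{M}_+=\{\mu:\mathcal{X}\to\mathbb{R}\mid\mu(x)>0\ \forall x\}$. For $\psi\in\mathbb{R}^{\mathcal X}$, $\|\psi\|_{\varpi,1}=\sum_x\varpi(x)|\psi(x)|$. Fixed throughout: real numbers $a,b>0$ and $p\in\mathcal{M}_+$ with $\|p\|_{\varpi,1}=1$. Logarithmic mean: for $u,v\ge 0$, $\theta(u,v)=\int_0^1u^{\xi}v^{1-\xi}\,d\xi$, i.e. $\theta(u,u)=u$, $\theta(u,v)=\frac{u-v}{\log u-\log v}$ for $u\ne v$ both positive, and $\theta(u,v)=0$ if $u=0$ or $v=0$. For $\mu\in\mathcal{M}$, $\hat\mu(x,y):=\theta(\mu(x),\mu(y))$. Admissible trajectories: for $\mu_0,\mu_1\in\mathcal{M}$, $\mathrm{CE}_p(\mu_0,\mu_1;[0,1])$ is the set of triples $(\mu_t,\psi_t,h_t)_{t\in[0,1]}$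 such that $t\mapsto\mu_t\in\mathcal{M}$ is absolutely continuous, $t\mapsto\psi_t\in\mathbb{R}^{\mathcal{X}}$ and $t\mapsto h_t\in\mathbb{R}$ are measurable, for a.e. $t\in[0,1]$ and all $x\in\mathcal{X}$ $$\dot\mu_t(x)+\sum_{y\in\mathcal{X}}(\psi_t(y)-\psi_t(x))\hat\mu_t(x,y)K(x,y)=h_t\,p(x),$$ and $\mu_t|_{t=0}=\mu_0$, $\mu_t|_{t=1}=\mu_1$. Define $$\mathcal{W}^{a,b}_p(\mu_0,\mu_1)^2:=\inf\Big\{a^2\int_0^1h_t^2\,dt+b^2\int_0^1\frac12\sum_{x,y\in\mathcal{X}}(\psi_t(y)-\psi_t(x))^2\hat\mu_t(x,y)K(x,y)\varpi(x)\,dt\Big\},$$ the infimum being over $(\mu_t,\psi_t,h_t)_{t\in[0,1]}\in\mathrm{CE}_p(\mu_0,\mu_1;[0,1])$, and $\mathcal{W}^{a,b}_p(\mu_0,\mu_1)\ge0$ is its square root. This is a metric on $\mathcal{M}$. *)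

(* Defs.v *)
From mathcomp Require Import all_boot all_order all_algebra.
From mathcomp Require Import all_classical all_reals all_analysis measurable_realfun.
From mathcomp Require Import ring.

Set Implicit Arguments.
Unset Strict Implicit.
Unset Printing Implicit Defensive.

Import Order.TTheory GRing.Theory Num.Theory.
Import numFieldNormedType.Exports.

Local Open Scope classical_set_scope.
Local Open Scope ring_scope.

Section markov_kernel.
Context {R : realType} {X : finType}.
Implicit Types (K : X -> X -> R) (w psi : X -> R).

Definition markov_kernel K :=
  (forall x y, 0 <= K x y) /\ (forall x, \sum_y K x y = 1).

Fixpoint kernel_iter K n (x y : X) : R :=
  if n is m.+1 then \sum_z K x z * kernel_iter K m z y else (x == y)%:R.

Definition irreducible_kernel K := forall x y, exists n, 0 < kernel_iter K n x y.

Definition steady_state K w :=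
  [/\ forall x, 0 <= w x, \sum_x w x = 1 &
      forall x, w x = \sum_y w y * K y x].

Definition reversible K w := forall x y, K x y * w x = K y x * w y.

Definition norm1 w psi : R := \sum_x w x * `|psi x|.

End markov_kernel.

(* The convention 0 `^ 0 = 1 only affects the null sets {0} and {1}. *)
Definition logmean {R : realType} (u v : R) : R :=
  \int[lebesgue_measure]_(s in `[0, 1]) (u `^ s * v `^ (1 - s)).

Lemma logmean_cases {R : realType} (u v : R) : 0 <= u -> 0 <= v ->
  logmean u v = if (u == 0) || (v == 0) then 0
                else if u == v then u else (u - v) / (ln u - ln v).
Proof.
move=> u0 v0; rewrite /logmean.
have int_itvoo (f : R -> R) : {in `]0, 1[, f =1 cst 0} ->
    \int[lebesgue_measure]_(s in `[0, 1]) f s = 0.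
  move=> f0.
  have f0E : {in `]0, 1[%classic, (EFin \o f) =1 cst 0%E}.
    by move=> s /set_mem s01; rewrite /= f0.
  have mf : measurable_fun (`]0, 1[ : set R) f.
    have H : measurable_fun (`]0, 1[ : set R) (cst 0 : R -> R).
      exact: measurable_cst.
    refine (@eq_measurable_fun _ _ _ _ _ _ _ _ H).
    by move=> s /set_mem s01; exact/esym/f0.
  rewrite /Rintegral integral_itv_bndoo; last exact/measurable_EFinP.
  apply: (congr1 fine (_ : _ = 0%E)).
  by rewrite -[RHS](integral0 lebesgue_measure `]0, 1[); exact: eq_integral.
case: eqVneq => [->|un0] /=.
  apply: int_itvoo => s; rewrite in_itv /= => /andP[s0 _].
  by rewrite powR0 ?mul0r // gt_eqF.
case: eqVneq => [->|vn0] /=.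
  apply: int_itvoo => s; rewrite in_itv /= => /andP[_ s1].
  by rewrite powR0 ?mulr0 // subr_eq0 gt_eqF.
have {un0} {}u0 : 0 < u by rewrite lt_neqAle eq_sym un0.
have {vn0} {}v0 : 0 < v by rewrite lt_neqAle eq_sym vn0.
set c := ln u - ln v.
have -> : \int[lebesgue_measure]_(s in `[0, 1]) (u `^ s * v `^ (1 - s)) =
    \int[lebesgue_measure]_(s in `[0, 1]) (v * expR (c * s)).
  apply: eq_Rintegral => s _; rewrite /powR !gt_eqF // -expRD.
  rewrite -[in v * _](lnK v0) -expRD; congr expR; rewrite /c; ring.
case: eqVneq => [uv|uv].
  rewrite /c uv subrr; under eq_Rintegral do rewrite mul0r expR0 mulr1.
  rewrite Rintegral_cst //= lebesgue_measure_itv /= lte01 /=; ring.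
have c0 : c != 0.
  by apply: contra_neq uv => /eqP; rewrite subr_eq0 => /eqP/ln_inj; apply; rewrite posrE.
have dF (x : R) : is_derive x 1 (fun s : R => v / c * expR (c * s)) (v * expR (c * x)).
  apply: is_derive_eq.
  rewrite /GRing.scale /= mulr1; field; exact: c0.
rewrite /Rintegral (@continuous_FTC2 _ _ (fun s => v / c * expR (c * s))) //.
- rewrite /= mulr0 mulr1 expR0 /c expRB !lnK ?posrE //.
  by field; rewrite -/c c0 gt_eqF.
- by apply: derivable_within_continuous => x _.
- have cF (x : R) : {for x, continuous (fun s => v / c * expR (c * s))}.
    by apply/differentiable_continuous/derivable1_diffP/ex_derive.
  split; first by move=> x _; exact: ex_derive.
  + exact: cvg_at_right_filter (cF 0).
  + exact: cvg_at_left_filter (cF 1).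
- by move=> x _; rewrite derive1E derive_val.
Qed.

Definition absolutely_continuous {R : realType} (a b : R) (f : R -> R) :=
  forall e : R, 0 < e -> exists2 d : R, 0 < d &
    forall n (u v : 'I_n -> R),
      (forall i, a <= u i /\ u i <= v i /\ v i <= b) ->
      trivIset setT (fun i => `]u i, v i[%classic) ->
      \sum_i (v i - u i) < d ->
      \sum_i `|f (v i) - f (u i)| < e.

Section transport.
Context {R : realType} {X : finType}.
Implicit Types (K : X -> X -> R) (w p mu : X -> R).
Implicit Types (a b : R) (mut psit : R -> X -> R) (ht : R -> R).

Definition nonneg_densities : set (X -> R) := [set mu | forall x, 0 <= mu x].

Definition edge_mean mu x y : R := logmean (mu x) (mu y).

(* Curves are functions on the whole line of which only the values on [0, 1]
   matter. The derivative is two-sided; the two end points are negligible.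
   Measurability is Borel; passing to Lebesgue measurability only changes psit
   and ht on negligible sets. *)
Record CE K p mu0 mu1 mut psit ht : Prop := {
  CE_nonneg : forall t : R, t \in `[0, 1] -> nonneg_densities (mut t) ;
  CE_abs_cont : forall x, absolutely_continuous 0 1 (fun t => mut t x) ;
  CE_measurable_psi : forall x : X,
    measurable_fun (`[0, 1] : set R) (fun t => psit t x) ;
  CE_measurable_h : measurable_fun (`[0, 1] : set R) ht ;
  CE_eq : {ae lebesgue_measure, forall t : R, t \in `[0, 1] -> forall x,
    derivable (fun s : R => mut s x) t 1 /\
    (fun s : R => mut s x)^`()%classic t
      + \sum_y (psit t y - psit t x) * edge_mean (mut t) x y * K x y
      = ht t * p x} ;
  CE_start : mut 0 = mu0 ;
  CE_end : mut 1 = mu1 }.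

Definition action K w a b mut psit ht : \bar R :=
  ((a ^+ 2)%:E * \int[lebesgue_measure]_(t in `[0%R, 1%R]) (ht t ^+ 2)%:E
   + (b ^+ 2)%:E * \int[lebesgue_measure]_(t in `[0%R, 1%R])
       (2^-1 * \sum_x \sum_y
         (psit t y - psit t x) ^+ 2 * edge_mean (mut t) x y * K x y * w x)%:E)%E.

(* +oo when there is no admissible curve of finite action. *)
Definition Wdist K w p a b mu0 mu1 : \bar R :=
  sqrte (ereal_inf [set A | exists mut psit ht,
    CE K p mu0 mu1 mut psit ht /\ A = action K w a b mut psit ht]).

End transport.

Section metric_spaces.
Context {R : realType} {T : Type}.
Implicit Types (M : set T) (d : T -> T -> \bar R).

Definition is_metric_on M d :=
  [/\ forall x y, M x -> M y -> (0 <= d x y < +oo)%E,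
      forall x y, M x -> M y -> (d x y = 0%E <-> x = y),
      forall x y, M x -> M y -> d x y = d y x &
      forall x y z, M x -> M y -> M z -> (d x z <= d x y + d y z)%E].

Definition cauchy_seq d (u : nat -> T) :=
  forall e : R, 0 < e -> exists N : nat, forall m n : nat,
    (N <= m)%N -> (N <= n)%N -> (d (u m) (u n) < e%:E)%E.

Definition complete_metric_space M d :=
  is_metric_on M d /\
  forall u : nat -> T, (forall n, M (u n)) -> cauchy_seq d u ->
    exists2 l, M l & d (u n) l @[n --> \oo] --> 0%E.

End metric_spaces.

(* Main.v *)
(* A curve of action at most B^2 moves every density by at most a constant times
   B: the total mass sum_x w(x) mu(x) changes at rate h because the flux of a
   reversible kernel conserves mass, so along the curve the masses, hence the
   logarithmic means and by Cauchy-Schwarz the fluxes, are controlled by the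
   action. Hence the distance separates points and a Cauchy sequence for it is
   Cauchy coordinatewise, with a nonnegative coordinatewise limit l.

   Conversely, densities close to l coordinatewise are close to l for the
   distance, even when l vanishes somewhere: creating the mass s p costs only a s,
   and between densities bounded below by s min p the linear interpolation is
   driven by the solution of a weighted Poisson equation on the graph, at a cost
   proportional to the l^1 distance. The same construction shows that the
   distance is finite. Reversing and concatenating curves, with the time split
   proportional to the square roots of the actions, gives symmetry and the
   triangle inequality. *)
Require Import Defs.
From mathcomp Require Import all_boot all_order all_algebra.
From mathcomp Require Import all_classical all_reals all_analysis measurable_realfun.
From mathcomp Require Import ring lra.

Set Implicit Arguments.
Unset Strict Implicit.
Unset Printing Implicit Defensive.

Import Order.TTheory GRing.Theory Num.Theory.
Import numFieldNormedType.Exports.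
Local Open Scope classical_set_scope.
Local Open Scope ring_scope.

(** * Increments of absolutely continuous functions *)

(** All estimates concern single curves: [reachable B] keeps one curve with a length budget [B], and
    the infimum in [Wdist] is opened only in [reachable_Wdist_le] and [Wdist_lt_reachable], so that
    no minimizing curve is needed.

    Two obstacles shape the rest. A density is known only to be absolutely continuous with a
    derivative almost everywhere, so its increments are bounded directly from the epsilon-delta
    definition. And the logarithmic mean vanishes where a density does, so near such a density the
    Poisson equation has no uniform cost. Raising by [s p] restores a lower bound, but the constant
    [G] of the interpolation then depends on [s]: one fixes [s], then [G], and only then how close
    the two densities must be.

    In the other direction the flux bound is linear in the mass, because [logmean u v <= u + v].
    Hence mass is bounded before coordinates, and for a Cauchy sequence uniformly beyond one index.
    Cauchy-Schwarz in time appears as the pointwise inequality [2 x B <= x^2 + B^2], integrated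
    afterwards. *)

Section absolute_continuity.
Context {R : realType}.
Implicit Types (a b s t r : R) (f g F : R -> R).
Local Notation mu := (@lebesgue_measure R).

(** Compactness of the segment as a supremum argument: the supremum [c] of the points reached from
    [a] is itself reached, and the local hypothesis at [c] would step beyond it if [c < b]. *)
Lemma segment_local_to_global (P : R -> R -> Prop) a b : a <= b ->
  (forall s t r, a <= s -> s <= t -> t <= r -> r <= b ->
    P s t -> P t r -> P s r) ->
  (forall t, a <= t <= b -> exists2 d, 0 < d &
    forall s, a <= s <= b -> `|s - t| < d -> (s <= t -> P s t) /\ (t <= s -> P t s)) ->
  P a b.
Proof.
move=> ab Ptrans Ploc.
pose S : set R := [set t | a <= t <= b /\ P a t].
have Sa : S a.
  have aab : a <= a <= b by rewrite lexx.
  split=> //; have [d d0 /(_ a aab)] := Ploc a aab.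
  by rewrite subrr normr0 => /(_ d0) [H _]; exact: H.
have hsS : has_sup S.
  by split; [exists a | exists b => t [/andP[]]].
pose c := sup S.
have ac : a <= c by apply: sup_upper_bound.
have cb : c <= b by apply: ge_sup => //; [exists a | move=> t [/andP[]]].
have acb : a <= c <= b by rewrite ac.
have [d d0 locc] := Ploc c acb.
have Pc : P a c.
  have [s [/andP[sa sb] Ps] cs] := sup_adherent d0 hsS.
  have sc : s <= c by apply: sup_upper_bound => //; split=> //; rewrite sa.
  have ssb : a <= s <= b by rewrite sa.
  have [] := locc s ssb; first by rewrite ler0_norm ?subr_le0// opprB ltrBlDl -ltrBlDr.
  by move=> /(_ sc) Psc _; exact: (Ptrans a s c).
have [<-//|cltb] := eqVneq c b.
have {}cltb : c < b by rewrite lt_neqAle cltb.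
pose r := Num.min b (c + d / 2).
have cr : c < r by rewrite lt_min cltb ltrDl divr_gt0.
have rb : r <= b by rewrite ge_min lexx.
have arb : a <= r <= b by rewrite rb (le_trans ac (ltW cr)).
have rd : `|r - c| < d.
  rewrite gtr0_norm ?subr_gt0// ltrBlDl (@le_lt_trans _ _ (c + d / 2))//.
    by rewrite ge_min lexx orbT.
  by rewrite ltrD2l ltr_pdivrMr// ltr_pMr// ltrDr.
have [_ /(_ (ltW cr)) Pcr] := locc r arb rd.
have Sr : S r by split=> //; apply: (Ptrans a c r) => //; exact: ltW.
by have := @sup_upper_bound _ S hsS r Sr; rewrite leNgt cr.
Qed.

Lemma is_derive_local_estimate f t df e : is_derive t 1 f df -> 0 < e ->
  exists2 d, 0 < d & forall s, `|s - t| < d -> `|f s - f t - df * (s - t)| <= e * `|s - t|.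
Proof.
move=> [dft <-] e0.
have /cvgrPdist_le /(_ e e0) := dft.
rewrite /= -[lim _]/('D_1 f t) => -[d /= d0 H].
exists d => // s std.
have [->|st] := eqVneq s t; first by rewrite !subrr mulr0 subrr normr0 mulr0.
have st0 : s - t != 0 by rewrite subr_eq0.
have := H (s - t); rewrite /= sub0r normrN => /(_ std st0).
rewrite /GRing.scale /= mulr1 subrK => H1.
rewrite -ler_pdivrMr ?normr_gt0// -normfV -normrM; apply: le_trans H1.
by rewrite distrC mulrBl mulfK// mulrC.
Qed.

(** The recursive form orders the intervals from left to right, so they are disjoint automatically
    and adjacent chains are joined by list concatenation. *)
Fixpoint interval_chain (U : set R) s r (l : seq (R * R)) : Prop :=
  if l is uv :: l' then
    [/\ s <= uv.1, uv.1 <= uv.2, `]uv.1, uv.2[ `<=` U & interval_chain U uv.2 r l']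
  else s <= r.

Lemma interval_chain_le U s r l : interval_chain U s r l -> s <= r.
Proof.
by elim: l s => //= uv l IH s [su uv12 _ /IH]; apply: le_trans; exact: le_trans uv12.
Qed.

Lemma interval_chainW U s s' r l : s' <= s ->
  interval_chain U s r l -> interval_chain U s' r l.
Proof.
case: l => [|uv l] /= ss'; first exact: le_trans.
by move=> [? ? ? ?]; split => //; exact: le_trans ss' _.
Qed.

Lemma interval_chain_cat U s t r l l' : interval_chain U s t l ->
  interval_chain U t r l' -> interval_chain U s r (l ++ l').
Proof.
elim: l s => /= [s st|uv l IH s [? ? ? /IH{}IH] /IH H]; last by split.
exact: interval_chainW.
Qed.

Lemma interval_chain_measure U s r l : open U -> interval_chain U s r l ->
  ((\sum_(uv <- l) (uv.2 - uv.1))%:E <= mu (U `&` `]s, r[))%E.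
Proof.
move=> oU; elim: l s => [|[u v] l IH] s /=; first by rewrite big_nil measure_ge0.
move=> [su uv Uuv ch]; rewrite big_cons /= EFinD.
have vr := interval_chain_le ch.
apply: (@le_trans _ _ (mu (`]u, v[ `|` (U `&` `]v, r[)))); last first.
  apply: le_measure; rewrite ?inE.
  - by apply: measurableU => //; apply: measurableI => //; exact: open_measurable.
  - by apply: measurableI => //; exact: open_measurable.
  - move=> x [/[dup] xuv|[Ux]]; rewrite /= !in_itv/= => /andP[h1 h2].
      by split; [exact: Uuv|rewrite (le_lt_trans su)// (lt_le_trans h2)].
    by split=> //; rewrite h2 (le_lt_trans _ h1)// (le_trans su).
rewrite measureU//.
- apply: leeD; last exact: IH.
  rewrite [leRHS](lebesgue_measure_itv (Interval (BRight u) (BLeft v))) /= lte_fin.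
  by case: ltP => // vu; rewrite lee_fin subr_le0.
- by apply: measurableI => //; exact: open_measurable.
- apply/seteqP; split=> // x [] /=; rewrite !in_itv/= => /andP[_ xv] [_ /andP[vx _]].
  by move: (lt_trans xv vx); rewrite ltxx.
Qed.

Lemma interval_chain_nth U s r l i : interval_chain U s r l -> (i < size l)%N ->
  [/\ s <= (nth (0, 0) l i).1, (nth (0, 0) l i).1 <= (nth (0, 0) l i).2 &
      (nth (0, 0) l i).2 <= r].
Proof.
elim: l s i => //= uv l IH s [|i] [su uv12 _ ch] /=.
  by move=> _; split=> //; exact: interval_chain_le ch.
rewrite ltnS => /(IH _ _ ch) [h1 h2 h3]; split=> //.
by rewrite (le_trans su)// (le_trans uv12).
Qed.

Lemma interval_chain_sorted U s r l i j : interval_chain U s r l ->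
  (i < j)%N -> (j < size l)%N -> (nth (0, 0) l i).2 <= (nth (0, 0) l j).1.
Proof.
elim: l s i j => //= uv l IH s [|i] [|j] [su uv12 _ ch] //=.
  by move=> _; rewrite ltnS => /(interval_chain_nth ch)[].
by rewrite !ltnS; exact: IH ch.
Qed.

Lemma interval_chain_trivIset U s r l : interval_chain U s r l ->
  trivIset setT (fun i : 'I_(size l) =>
    `](nth (0, 0) l i).1, (nth (0, 0) l i).2[%classic).
Proof.
move=> ch i j _ _ [x []] /=; rewrite !in_itv /= => /andP[i1 i2] /andP[j1 j2].
apply/val_inj; have [ij|ij|//] := ltngtP i j.
- have := interval_chain_sorted ch ij (ltn_ord j).
  by move=> /(lt_le_trans i2)/lt_trans/(_ j1); rewrite ltxx.
- have := interval_chain_sorted ch ij (ltn_ord i).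
  by move=> /(lt_le_trans j2)/lt_trans/(_ i1); rewrite ltxx.
Qed.

(** The intervals of a chain are disjoint and lie in [U], so the measure of [U] bounds their total
    length, whatever their number. *)
Lemma absolutely_continuous_chain a b f e : absolutely_continuous a b f -> 0 < e ->
  exists2 d, 0 < d & forall U l, open U -> (mu U < d%:E)%E -> interval_chain U a b l ->
    \sum_(uv <- l) `|f uv.2 - f uv.1| < e.
Proof.
move=> /[apply] -[d d0 H]; exists d => // U l oU mUd ch.
rewrite (big_nth (0, 0)) big_mkord.
apply: (H _ (fun i : 'I_(size l) => (nth (0, 0) l i).1) (fun i => (nth (0, 0) l i).2)).
- by move=> i; have [] := interval_chain_nth ch (ltn_ord i).
- exact: interval_chain_trivIset ch.
- rewrite (_ : \sum_i _ = \sum_(uv <- l) (uv.2 - uv.1)); last first.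
    by rewrite (big_nth (0, 0)) big_mkord.
  rewrite -lte_fin; apply: le_lt_trans mUd.
  apply: le_trans (interval_chain_measure oU ch) _.
  apply: le_measure; rewrite ?inE//; last exact: open_measurable.
  by apply: measurableI => //; exact: open_measurable.
Qed.

Lemma negligible_open_cover (N : set R) e : mu.-negligible N -> 0 < e ->
  exists2 U, open U & N `<=` U /\ (mu U < e%:E)%E.
Proof.
move=> [A [mA A0 NA]] e0.
have [|U [oU AU muU]] := lebesgue_regularity_outer mA _ e0.
  by rewrite [X in (X < _)%E]A0.
exists U => //; split; first exact: subset_trans AU.
rewrite -(setDUK AU); apply: le_lt_trans (measureU2 _ _ _) _ => //.
  by apply: measurableD => //; exact: open_measurable.
by rewrite [X in (X + _)%E]A0 add0e.
Qed.

(* The exceptional null set is covered by an open set of small measure, on which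
   f varies little by absolute continuity. *)
Lemma absolutely_continuous_le_primitive a b f F g s r :
  absolutely_continuous a b f -> {homo F : x y / x <= y} ->
  {ae mu, forall t, t \in `[a, b] ->
    (exists2 df, is_derive t 1 f df & `|df| <= g t) /\ is_derive t 1 F (g t)} ->
  a <= s -> s <= r -> r <= b ->
  `|f r - f s| <= F r - F s.
Proof.
move=> fAC Fhomo.
pose good t := t \in `[a, b] -> (exists2 df, is_derive t 1 f df & `|df| <= g t) /\
   is_derive t 1 F (g t).
move=> /negligible_open_cover cover as_ sr rb.
apply/ler_addgt0Pl => e e0.
(* The allowance: [e' / 2] per unit of time for the points with a derivative and [e' / 2] once for
   the whole exceptional set, in total [e / 2]. *)
have [e' [e'0 e'E]] : exists e', 0 < e' /\ e' * (r - s + 1) = e.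
  exists (e / (r - s + 1)); have rs1 : 0 < r - s + 1 by lra.
  by rewrite divr_gt0// divfK// gt_eqF.
have e'20 : 0 < e' / 2 by rewrite divr_gt0.
have [d d0 chain_small] := absolutely_continuous_chain fAC e'20.
have [U oU [NU muU]] := cover _ d0.
(* The wanted estimate up to two errors that add up under concatenation: a linear one and the
   variation of [f] over a chain inside [U]. *)
pose P x y := exists2 l, interval_chain U x y l &
  `|f y - f x| <= F y - F x + e' / 2 * (y - x) + \sum_(uv <- l) `|f uv.2 - f uv.1|.
suff [l ch Hl] : P s r.
  have : \sum_(uv <- l) `|f uv.2 - f uv.1| < e' / 2.
    apply: (chain_small U) => //; apply: interval_chainW as_ _.
    have : interval_chain U r b [::] by [].
    by move=> /(interval_chain_cat ch); rewrite cats0.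
  move: e'0 e'E Hl; move: (\sum_(_ <- _) _) => S; clear -sr; nra.
apply: segment_local_to_global => //.
  move=> x y z sx xy yz zr [l ch Hl] [l' ch' Hl'].
  exists (l ++ l'); first exact: interval_chain_cat ch ch'.
  rewrite big_cat /= -(subrKA (f y)) (le_trans (ler_normD _ _))//.
  move: Hl Hl'; move: (\sum_(_ <- l) _) (\sum_(_ <- l') _) => S S'.
  move: (`|_ - _|) (`|_ - _|) => A B; clear; nra.
have gap_ge0 x y : x <= y -> 0 <= F y - F x + e' / 2 * (y - x).
  by move=> xy; rewrite addr_ge0 ?subr_ge0 ?Fhomo// mulr_ge0 ?subr_ge0// ltW.
move=> t /andP[st tr].
(* At an exceptional point the whole short interval lies in the open set [U] and is put in the
   chain; at a good point the chain is empty and the derivatives are compared. *)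
have [Nt|] := pselect ((~` [set t | good t]) t).
  have [d' /= d'0 dU] : nbhs t U by apply: oU; exact: NU.
  exists d' => // x /andP[sx xr] xt; split=> xt'.
  - exists [:: (x, t)]; last by rewrite big_seq1/= lerDr gap_ge0.
    split=> //= y; rewrite /= in_itv/= => /andP[xy yt]; apply: dU => /=.
    move: xt; rewrite distrC !ger0_norm ?subr_ge0//; last exact: ltW.
    by apply: le_lt_trans; rewrite lerD2l lerN2 ltW.
  - exists [:: (t, x)]; last by rewrite big_seq1/= lerDr gap_ge0.
    split=> //= y; rewrite /= in_itv/= => /andP[xy yt]; apply: dU => /=.
    move: xt; rewrite [`|t - y|]distrC !ger0_norm ?subr_ge0//; last exact: ltW.
    by apply: le_lt_trans; rewrite lerD2r ltW.
have tab : t \in `[a, b] by rewrite in_itv/= (le_trans as_ st) (le_trans tr rb).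
move=> /contrapT /= /(_ tab) [[df ft dfgt] Ft].
(* Near [t], [f] moves at most [g t + e' / 4] and [F] at least [g t - e' / 4] per unit of time,
   which leaves the permitted gap [e' / 2]. *)
have e40 : 0 < e' / 4 by rewrite divr_gt0.
have [d1 d10 H1] := is_derive_local_estimate ft e40.
have [d2 d20 H2] := is_derive_local_estimate Ft e40.
exists (Num.min d1 d2); first by rewrite lt_min d10.
move=> x /andP[sx xr]; rewrite lt_min => /andP[/H1{}H1 /H2{}H2].
have {}H1 : `|f x - f t| <= (g t + e' / 4) * `|x - t|.
  rewrite -(subrK (df * (x - t)) (f x - f t)) (le_trans (ler_normD _ _))// mulrDl addrC.
  by rewrite lerD// normrM ler_wpM2r.
split=> xt; exists [::] => //; rewrite big_nil addr0.
- move: H1 H2; rewrite (ler0_norm (_ : x - t <= 0)) ?subr_le0// [`|f t - _|]distrC.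
  move: (`|f x - _|) => A; rewrite ler_norml => H1 /andP[_].
  by move: (F x) (F t) (g t) H1 => B C D; clear; lra.
- move: H1 H2; rewrite (ger0_norm (_ : 0 <= x - t)) ?subr_ge0//.
  move: (`|f x - _|) => A; rewrite ler_norml => H1 /andP[+ _].
  by move: (F x) (F t) (g t) H1 => B C D; clear; lra.
Qed.

(** The comparison function is the primitive of [g] from minus infinity: monotone since [g] is
    nonnegative, with derivative [g] almost everywhere by Lebesgue differentiation, and with values
    between [0] and the full integral. *)
Lemma absolutely_continuous_increment_le a b f g s r :
  absolutely_continuous a b f -> mu.-integrable setT (EFin \o g) ->
  (forall t, 0 <= g t) ->
  {ae mu, forall t, t \in `[a, b] -> exists2 df, is_derive t 1 f df & `|df| <= g t} ->
  a <= s -> s <= r -> r <= b ->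
  `|f r - f s| <= \int[mu]_t g t.
Proof.
move=> fAC ig g0 dfg as_ sr rb.
pose F x := (\int[mu]_(t in `]-oo, x]) (g t))%R.
have igx (D : set R) : measurable D -> mu.-integrable D (EFin \o g).
  by move=> mD; apply: integrableS ig.
have Fhomo : {homo F : x y / x <= y}.
  move=> x y xy; rewrite /F /Rintegral fine_le//.
  - exact: integrable_fin_num (igx _ _).
  - exact: integrable_fin_num (igx _ _).
  - apply: ge0_subset_integral => //=.
    + by case/integrableP: (igx `]-oo, y]%classic (measurable_itv _)).
    + by move=> t _; rewrite lee_fin.
    + by move=> t; rewrite /= !in_itv/= => /le_trans; exact.
have F_le x : F x <= \int[mu]_t g t.
  rewrite /F /Rintegral fine_le//.
  - exact: integrable_fin_num (igx _ _).
  - exact: integrable_fin_num ig.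
  - apply: ge0_subset_integral => //=.
    + by case/integrableP: ig.
    + by move=> t _; rewrite lee_fin.
have F_ge0 x : 0 <= F x by apply: Rintegral_ge0.
suff /le_trans : `|f r - f s| <= F r - F s.
  by apply; rewrite lerBlDr (le_trans (F_le r))// lerDl.
have dF : {ae mu, forall x, derivable F x 1 /\ F^`()%classic x = g x}.
  apply: FTC1Ny; first by move=> y; exact: igx.
  exact: open_integrable_locally openT ig.
apply: absolutely_continuous_le_primitive fAC Fhomo _ as_ sr rb.
apply: filterS2 dfg dF; first exact: (ae_filter_ringOfSetsType mu).
move=> t h1 [h2 h3] tab; split; first exact: h1.
by apply: DeriveDef => //; rewrite -derive1E.
Qed.

End absolute_continuity.

(** * Affine changes of time *)

Section affine_change_of_variables.
Context {R : realType}.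
Implicit Types (c e : R).
Local Notation mu := (@lebesgue_measure R).

Let affine c e : measurableTypeR R -> measurableTypeR R := fun t => c * t + e.

Let measurable_affine c e : measurable_fun setT (affine c e).
Proof. by apply: measurable_funD => //; exact: mulrl_measurable. Qed.

(** Uniqueness of Lebesgue measure: the scaled pushforward has the right value on half-open
    intervals. Negative [c], needed for time reversal, swaps the closed end. *)
Lemma lebesgue_measure_affine_preimage c e (A : set R) : c != 0 -> measurable A ->
  mu A = (`|c|%:E * mu [set t | A ((c * t + e)%R)])%E.
Proof.
move=> c0 mA.
pose nu' : {measure set (measurableTypeR R) -> \bar R} :=
  mscale (NngNum (normr_ge0 c)) (pushforward mu (affine c e)).
pose nu := nu' (measurable_affine c e).
transitivity (nu A); last by [].
apply: (@lebesgue_measure_unique R nu) => // _ [[a b]] _ <-.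
rewrite /nu /nu' /= /mscale /= /pushforward.
have [cgt0|clt0|c00] := ltgtP 0 c; last by rewrite -c00 eqxx in c0.
- rewrite (_ : _ @^-1` _ = `](a - e) / c, (b - e) / c]%classic); last first.
    apply/seteqP; split => t; rewrite /= /affine !in_itv/=;
    by rewrite ltr_pdivrMr// ler_pdivlMr// ltrBlDr lerBrDr [t * c]mulrC.
  rewrite !lebesgue_measure_itv /= !lte_fin gtr0_norm// ltr_pM2r ?invr_gt0// ltrD2r.
  by case: ifP => _; rewrite ?mule0// -EFinM; congr EFin; field.
- rewrite (_ : _ @^-1` _ = `[(b - e) / c, (a - e) / c[%classic); last first.
    apply/seteqP; split => t; rewrite /= /affine !in_itv/=;
    by rewrite ler_ndivrMr// ltr_ndivlMr// ltrBlDr lerBrDr [t * c]mulrC andbC.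
  rewrite !lebesgue_measure_itv /= !lte_fin ltr0_norm// ltr_nM2r ?invr_lt0// ltrD2r.
  by case: ifP => _; rewrite ?mule0// -EFinM; congr EFin; field; rewrite lt_eqF.
Qed.

Lemma ge0_integral_affine c e (D : set R) (f : R -> \bar R) : c != 0 ->
  measurable D -> measurable_fun D f -> (forall t, D t -> 0 <= f t)%E ->
  (\int[mu]_(t in D) f t =
   `|c|%:E * \int[mu]_(t in [set t | D (c * t + e)%R]) f (c * t + e)%R)%E.
Proof.
move=> c0 mD mf f0.
pose nu' : {measure set (measurableTypeR R) -> \bar R} :=
  mscale (NngNum (normr_ge0 c)) (pushforward mu (affine c e)).
pose nu := nu' (measurable_affine c e).
rewrite (eq_measure_integral nu); last first.
  by move=> A mA _; exact: lebesgue_measure_affine_preimage.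
rewrite ge0_integral_mscale//=; congr (_ * _)%E.
rewrite ge0_integral_pushforward//.
by move=> t /set_mem; exact: f0.
Qed.

Lemma measurable_affine_preimage c e (D : set R) : measurable D ->
  measurable [set t | D (c * t + e)].
Proof.
by move=> mD; rewrite -[X in measurable X]setTI; exact: measurable_affine.
Qed.

Lemma measurable_fun_affine d (T : measurableType d) c e (D : set R) (f : R -> T) :
  measurable D -> measurable_fun D f ->
  measurable_fun [set t | D (c * t + e)] (fun t => f (c * t + e)).
Proof.
move=> mD mf; apply: (measurable_comp (F := D) (f := f) (g := affine c e)) => //.
- by move=> _ [t Dt <-].
- by apply: measurable_funS (measurable_affine c e).
Qed.

Lemma ae_affine c e (P : R -> Prop) : c != 0 ->
  {ae mu, forall t, P t} -> {ae mu, forall t, P (c * t + e)}.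
Proof.
move=> c0 [A [mA A0 PA]]; exists [set t | A (c * t + e)]; split.
- exact: measurable_affine_preimage.
- have /esym/eqP := lebesgue_measure_affine_preimage e c0 mA.
  by rewrite [mu A]A0 mule_eq0 eqe normr_eq0 (negbTE c0)/= => /eqP.
- by move=> t /= /PA.
Qed.

End affine_change_of_variables.

(** * Stability of absolute continuity: sums, affine time changes, gluing *)

Section absolutely_continuous_operations.
Context {R : realType}.
Implicit Types (a b c e k t : R) (f g : R -> R).

Lemma absolutely_continuous_uniform a b f e : absolutely_continuous a b f -> 0 < e ->
  exists2 d, 0 < d & forall x y, a <= x -> x <= y -> y <= b -> y - x < d ->
    `|f y - f x| < e.
Proof.
move=> /[apply] -[d d0 H]; exists d => // x y ax xy yb yxd.
have := H 1%N (fun=> x) (fun=> y); rewrite !big_ord1; apply => //.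
by move=> i j _ _ _; rewrite !ord1.
Qed.

Lemma absolutely_continuous_measurable a b f : absolutely_continuous a b f ->
  measurable_fun `[a, b] f.
Proof.
move=> fAC; have [ba|ab] := ltP b a.
  by rewrite set_itv_ge ?bnd_simp -?ltNge//; exact: measurable_fun_set0.
(* Nothing is known of [f] outside the segment. Since [clip] is 1-Lipschitz, [f \o clip] is
   continuous on the whole line, and it agrees with [f] on the segment. *)
pose clip t := Num.max a (Num.min b t).
have a_clip t : a <= clip t by rewrite le_max lexx.
have clip_b t : clip t <= b by rewrite ge_max ab ge_min lexx.
have clipD x y : x <= y -> 0 <= clip y - clip x <= y - x.
  by rewrite /clip !maxEle !minEle; do !case: ifPn; rewrite -?ltNge; clear -ab; lra.
have cf : continuous (f \o clip).
  move=> t; apply/cvgrPdist_lt => e e0.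
  have [d d0 H] := absolutely_continuous_uniform fAC e0.
  near=> s => /=; have td : `|t - s| < d by near: s; exact: cvgr_dist_lt.
  have [ts|st] := leP t s.
  - rewrite distrC; have /andP[h1 h2] := clipD _ _ ts.
    apply: H => //; first by rewrite -subr_ge0.
    by move: td; rewrite ler0_norm ?subr_le0// opprB; exact: le_lt_trans.
  - have /andP[h1 h2] := clipD _ _ (ltW st).
    apply: H => //; first by rewrite -subr_ge0.
    by move: td; rewrite gtr0_norm ?subr_gt0//; exact: le_lt_trans.
apply: (eq_measurable_fun (f \o clip)).
  move=> t /set_mem; rewrite /= in_itv/= => /andP[at_ tb].
  by rewrite /clip (min_idPr tb) (max_idPr at_).
by apply: measurable_funTS; exact: continuous_measurable_fun.
Unshelve. all: by end_near. Qed.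

Lemma absolutely_continuousD a b f g : absolutely_continuous a b f ->
  absolutely_continuous a b g -> absolutely_continuous a b (fun t => f t + g t).
Proof.
move=> fAC gAC e e0; have e20 : 0 < e / 2 by rewrite divr_gt0.
have [d1 d10 H1] := fAC _ e20; have [d2 d20 H2] := gAC _ e20.
exists (Num.min d1 d2); first by rewrite lt_min d10.
move=> n u v uv tuv; rewrite lt_min => /andP[/(H1 _ _ _ uv tuv){}H1 /(H2 _ _ _ uv tuv){}H2].
rewrite [e]splitr; apply: le_lt_trans (ltrD H1 H2).
rewrite -big_split /=; apply: ler_sum => i _.
by rewrite opprD addrACA ler_normD.
Qed.

Lemma absolutely_continuous_lipschitz a b k f :
  (forall x y, x <= y -> `|f y - f x| <= k * (y - x)) -> absolutely_continuous a b f.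
Proof.
move=> fk e e0; have k10 : 0 < `|k| + 1 by rewrite ltr_wpDl.
exists (e / (`|k| + 1)); first by rewrite divr_gt0.
move=> n u v uv _ ; rewrite ltr_pdivlMr//; apply: le_lt_trans.
rewrite mulr_suml; apply: ler_sum => i _; have [_ [uvi _]] := uv i.
rewrite (le_trans (fk _ _ uvi))// mulrC ler_wpM2l ?subr_ge0//.
by rewrite (le_trans (ler_norm _))// lerDl.
Qed.

Lemma absolutely_continuousM a b k f : absolutely_continuous a b f ->
  absolutely_continuous a b (fun t => k * f t).
Proof.
move=> fAC e e0; have k10 : 0 < `|k| + 1 by rewrite ltr_wpDl.
have [d d0 H] := fAC (e / (`|k| + 1)) (divr_gt0 e0 k10); exists d => // n u v uv tuv ud.
have := H n u v uv tuv ud; rewrite ltr_pdivlMr//; apply: le_lt_trans.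
rewrite mulr_suml; apply: ler_sum => i _; rewrite -mulrBr normrM mulrC ler_wpM2l//.
by rewrite lerDl.
Qed.

Lemma eq_absolutely_continuous a b f g : (forall t, a <= t <= b -> f t = g t) ->
  absolutely_continuous a b f -> absolutely_continuous a b g.
Proof.
move=> fg fAC e /fAC [d d0 H]; exists d => // n u v uv tuv ud.
rewrite (eq_bigr (fun i => `|f (v i) - f (u i)|)); first exact: H.
move=> i _; have [h1 [h2 h3]] := uv i.
by rewrite !fg// ?h1 ?h3 ?(le_trans h1 h2) ?(le_trans h2 h3).
Qed.

Lemma absolutely_continuous_sum (I : Type) (s : seq I) a b (F : I -> R -> R) :
  (forall i, absolutely_continuous a b (F i)) ->
  absolutely_continuous a b (fun t => \sum_(i <- s) F i t).
Proof.
move=> FAC; elim: s => [|i s IH].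
  apply: (@absolutely_continuous_lipschitz _ _ 0) => x y _.
  by rewrite !big_nil subrr normr0 mul0r.
apply: eq_absolutely_continuous (absolutely_continuousD (FAC i) IH) => t _.
by rewrite big_cons.
Qed.

Lemma absolutely_continuous_affine a b a' b' c e f : c != 0 ->
  (forall t, a' <= t <= b' -> a <= c * t + e <= b) ->
  absolutely_continuous a b f ->
  absolutely_continuous a' b' (fun t => f (c * t + e)).
Proof.
move=> c0 sub fAC E /fAC [d d0 H]; exists (d / `|c|); first by rewrite divr_gt0// normr_gt0.
move=> n u v uv tuv; rewrite ltr_pdivlMr ?normr_gt0// => ud.
have uvE i : [/\ u i <= v i, a <= c * u i + e <= b & a <= c * v i + e <= b].
  have [h1 [h2 h3]] := uv i.
  by split=> //; apply: sub; rewrite ?h1 ?h3 ?(le_trans h1 h2) ?(le_trans h2 h3).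
have [cgt0|clt0|c00] := ltgtP 0 c; last by rewrite -c00 eqxx in c0.
- apply: (H n (fun i => c * u i + e) (fun i => c * v i + e)).
  + move=> i; have [h /andP[-> _] /andP[_ ->]] := uvE i.
    by rewrite lerD2r ler_pM2l.
  + move=> i j _ _ [x [/= hi hj]]; apply: tuv => //; exists ((x - e) / c).
    by move: hi hj; rewrite /= !in_itv/= ![c * _]mulrC !ltr_pdivlMr//
      !ltr_pdivrMr// !ltrBrDr !ltrBlDr.
  + move: ud; rewrite mulr_suml; congr (_ < _); apply: eq_bigr => i _.
    by rewrite gtr0_norm//; ring.
- under eq_bigr do rewrite distrC.
  apply: (H n (fun i => c * v i + e) (fun i => c * u i + e)).
  + move=> i; have [h /andP[_ ->] /andP[-> _]] := uvE i.
    by rewrite lerD2r ler_nM2l.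
  + move=> i j _ _ [x [/= hi hj]]; apply: tuv => //; exists ((x - e) / c).
    move: hi hj; rewrite /= !in_itv/= ![c * _]mulrC !ltr_ndivlMr// !ltr_ndivrMr//.
    by rewrite !ltrBrDr !ltrBlDr => /andP[-> ->] /andP[-> ->].
  + move: ud; rewrite mulr_suml; congr (_ < _); apply: eq_bigr => i _.
    by rewrite ltr0_norm//; ring.
Qed.

Lemma absolutely_continuous_minr a b t0 f : absolutely_continuous a t0 f -> a <= t0 ->
  absolutely_continuous a b (fun t => f (Num.min t t0)).
Proof.
move=> fAC at0 e /fAC [d d0 H]; exists d => // n u v uv tuv ud.
apply: (H n (fun i => Num.min (u i) t0) (fun i => Num.min (v i) t0)).
- move=> i; have [h1 [h2 h3]] := uv i.
  by split; [rewrite le_min h1|split; [exact: le_min2|rewrite ge_min lexx orbT]].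
- move=> i j _ _ [x [/= hi hj]]; apply: tuv => //; exists x; move: hi hj.
  rewrite /= !in_itv/= !gt_min !lt_min.
  by move=> /andP[/orP[->|+] /andP[-> h]] /andP[/orP[->|+] /andP[-> _]] //;
    rewrite ltNge (ltW h).
- apply: le_lt_trans ud; apply: ler_sum => i _; have [h1 [h2 h3]] := uv i.
  by rewrite ?maxEle ?minEle; do !case: ifPn; rewrite -?ltNge; clear -h2; lra.
Qed.

Lemma absolutely_continuous_maxr a b t0 f : absolutely_continuous t0 b f -> t0 <= b ->
  absolutely_continuous a b (fun t => f (Num.max t t0)).
Proof.
move=> fAC t0b e /fAC [d d0 H]; exists d => // n u v uv tuv ud.
apply: (H n (fun i => Num.max (u i) t0) (fun i => Num.max (v i) t0)).
- move=> i; have [h1 [h2 h3]] := uv i.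
  by split; [rewrite le_max lexx orbT|split; [exact: le_max2|rewrite ge_max h3]].
- move=> i j _ _ [x [/= hi hj]]; apply: tuv => //; exists x; move: hi hj.
  rewrite /= !in_itv/= !gt_max !lt_max.
  by move=> /andP[/andP[-> h] /orP[->|+]] /andP[/andP[-> _] /orP[->|+]] //;
    rewrite ltNge (ltW h).
- apply: le_lt_trans ud; apply: ler_sum => i _; have [h1 [h2 h3]] := uv i.
  by rewrite ?maxEle ?minEle; do !case: ifPn; rewrite -?ltNge; clear -h2; lra.
Qed.

(** The glued function equals [f (min t t0) + g (max t t0) - f t0]; this spares cutting the
    intervals that straddle [t0]. *)
Lemma absolutely_continuous_glue a b t0 f g : a <= t0 -> t0 <= b -> f t0 = g t0 ->
  absolutely_continuous a t0 f -> absolutely_continuous t0 b g ->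
  absolutely_continuous a b (fun t => if t <= t0 then f t else g t).
Proof.
move=> at0 t0b fg fAC gAC.
apply: (@eq_absolutely_continuous _ _
    (fun t => f (Num.min t t0) + g (Num.max t t0) + - f t0)).
  move=> t _; case: leP => [|/ltW] tt0; first by rewrite -fg addrK.
  by rewrite addrAC subrr add0r.
apply: absolutely_continuousD; last first.
  by apply: (@absolutely_continuous_lipschitz _ _ 0) => x y _; rewrite subrr normr0 mul0r.
by apply: absolutely_continuousD;
  [exact: absolutely_continuous_minr|exact: absolutely_continuous_maxr].
Qed.

End absolutely_continuous_operations.

(** * The logarithmic mean *)

Section logarithmic_mean.
Context {R : realType}.
Implicit Types (u v m : R).

(** Inversion is reduced to the measurable real power [-1] of [f ^+ 2], times [f]; at zeros of [f]
    both sides are [0] by the convention for the inverse of [0]. *)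
Lemma measurable_funVr d (T : measurableType d) (D : set T) (f : T -> R) :
  measurable_fun D f -> measurable_fun D (fun t => (f t)^-1).
Proof.
move=> mf; apply: (@eq_measurable_fun _ _ _ _ D (fun t => f t * (f t ^+ 2) `^ (-1))).
  move=> t _; rewrite powR_inv1 ?sqr_ge0//.
  have [->|ft0] := eqVneq (f t) 0; first by rewrite mul0r invr0.
  by rewrite expr2 invfM mulrA divff// mul1r.
apply: measurable_funM => //.
apply: (measurableT_comp (measurable_powR (-1))); exact: measurable_funX.
Qed.

Lemma logmean_ge0 u v : 0 <= logmean u v.
Proof. by rewrite /logmean; apply: Rintegral_ge0 => t _; rewrite mulr_ge0// powR_ge0. Qed.

Lemma logmeanC u v : 0 <= u -> 0 <= v -> logmean u v = logmean v u.
Proof.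
move=> u0 v0; rewrite !logmean_cases// orbC [v == u]eq_sym.
case: ifPn => // _; case: eqVneq => // _.
by rewrite -[u - v]opprB -[ln u - ln v]opprB invrN mulrNN.
Qed.

(** Both bounds are [ln x <= x - 1], taken at [u / v] and at [v / u]. *)
Lemma logmean_bounds u v : 0 < v -> v <= u -> v <= logmean u v <= u.
Proof.
move=> v0; have v0' := ltW v0; rewrite le_eqVlt => /predU1P[<-|vu].
  by rewrite logmean_cases// (gt_eqF v0) eqxx /= lexx.
have u0 := lt_trans v0 vu; have u0' := ltW u0.
rewrite logmean_cases// (gt_eqF u0) (gt_eqF v0) (gt_eqF vu) /=.
have d0 : 0 < ln u - ln v by rewrite subr_gt0 ltr_ln ?posrE.
have ln_sub (x : R) : 0 < x -> ln x <= x - 1.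
  by move=> x0; rewrite -[x in ln x](subrKC 1) le_ln1Dx// ltrBDl subrr.
rewrite ler_pdivlMr// ler_pdivrMr//; apply/andP; split.
- have := ln_sub (u / v) (divr_gt0 u0 v0).
  rewrite ln_div ?posrE// -(ler_pM2l v0) => /le_trans; apply.
  by rewrite mulrBr mulrCA divff ?gt_eqF// !mulr1.
- have := ln_sub (v / u) (divr_gt0 v0 u0).
  rewrite ln_div ?posrE// -(ler_pM2l u0) [leRHS]mulrBr mulrCA divff ?gt_eqF// !mulr1.
  by rewrite -lerN2 !opprB -mulrN opprB mulrC.
Qed.

Lemma logmean_le u v : 0 <= u -> 0 <= v -> logmean u v <= u + v.
Proof.
move=> u0 v0.
have [u00|un0] := eqVneq u 0; first by rewrite logmean_cases// u00 eqxx /= add0r.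
have [v00|vn0] := eqVneq v 0; first by rewrite logmean_cases// v00 eqxx orbT /= addr0.
have up : 0 < u by rewrite lt_neqAle eq_sym un0.
have vp : 0 < v by rewrite lt_neqAle eq_sym vn0.
have [uv|/ltW vu] := leP u v.
- rewrite logmeanC//; have /andP[_ h] := logmean_bounds up uv.
  by rewrite (le_trans h)// lerDr.
- have /andP[_ h] := logmean_bounds vp vu.
  by rewrite (le_trans h)// lerDl.
Qed.

Lemma logmean_ge m u v : 0 < m -> m <= u -> m <= v -> m <= logmean u v.
Proof.
move=> m0 mu mv; have up := lt_le_trans m0 mu; have vp := lt_le_trans m0 mv.
have [uv|/ltW vu] := leP u v.
- rewrite (logmeanC (ltW up) (ltW vp)); have /andP[h _] := logmean_bounds up uv.
  exact: le_trans h.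
- have /andP[h _] := logmean_bounds vp vu; exact: le_trans h.
Qed.

Lemma measurable_logmean d (T : measurableType d) (D : set T) (f g : T -> R) :
  measurable D -> (forall t, D t -> 0 <= f t) -> (forall t, D t -> 0 <= g t) ->
  measurable_fun D f -> measurable_fun D g ->
  measurable_fun D (fun t => logmean (f t) (g t)).
Proof.
move=> mD f0 g0 mf mg.
apply: (@eq_measurable_fun _ _ _ _ D (fun t => if (f t == 0) || (g t == 0) then 0
  else if f t == g t then f t else (f t - g t) / (ln (f t) - ln (g t)))).
  by move=> t /set_mem Dt; rewrite logmean_cases// ?f0 ?g0.
have mln h : measurable_fun D h -> measurable_fun D (fun t => ln (h t : R)).
  by move=> mh; apply: measurableT_comp => //; exact: measurable_ln.
have mor : measurable_fun D (fun t => (f t == 0) || (g t == 0)).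
  by apply: measurable_or; apply: measurable_fun_eqr.
apply: measurable_fun_if => //.
set E := _ `&` _; have ED : E `<=` D by move=> t [].
have mE : measurable E by apply: mor.
apply: measurable_fun_if => //.
- by apply: measurable_fun_eqr; [exact: measurable_funS mf|exact: measurable_funS mg].
- apply: measurable_funS mD _ mf; exact: subset_trans (@subIsetl _ _ _) ED.
- apply: (measurable_funS mD); first exact: subset_trans (@subIsetl _ _ _) ED.
  apply: measurable_funM; first exact: measurable_funB.
  by apply: measurable_funVr; apply: measurable_funB; exact: mln.
Qed.

End logarithmic_mean.

(** * Curves and reachability *)

Section reachability.
Context {R : realType} {X : finType}.
Context (K : X -> X -> R) (w p : X -> R) (a b : R).
Context (K_ge0 : forall x y, 0 <= K x y) (w_ge0 : forall x, 0 <= w x).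
Implicit Types (m psi : X -> R) (mut psit : R -> X -> R) (ht : R -> R).
Implicit Types (c e u v t B : R).
Local Notation mu := (@lebesgue_measure R).

Definition flux m psi x :=
  \sum_y (psi y - psi x) * edge_mean m x y * K x y.

Definition dirichlet m psi :=
  2^-1 * \sum_x \sum_y (psi y - psi x) ^+ 2 * edge_mean m x y * K x y * w x.

Definition lagrangian m psi h := a ^+ 2 * h ^+ 2 + b ^+ 2 * dirichlet m psi.

(** [CE] without its end conditions and on any time interval, because concatenation works on
    subintervals; [CEP] gives the equivalence on [[0, 1]]. *)
Record curve_on u v mut psit ht : Prop := CurveOn {
  curve_nonneg : forall t, t \in `[u, v] -> nonneg_densities (mut t) ;
  curve_abs_cont : forall x, absolutely_continuous u v (fun t => mut t x) ;
  curve_measurable_psi : forall x,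
    measurable_fun (`[u, v] : set R) (fun t => psit t x) ;
  curve_measurable_h : measurable_fun (`[u, v] : set R) ht ;
  curve_eq : {ae mu, forall t, t \in `[u, v] -> forall x,
    is_derive t 1 (fun s => mut s x) (ht t * p x - flux (mut t) (psit t) x)} }.

(* By Cauchy-Schwarz, [B] is an upper bound for the length of the curve; this
   quantity is invariant under affine changes of time and additive under
   concatenation with optimal time splitting. *)
Definition reachable B u v m0 m1 := exists mut psit ht,
  [/\ curve_on u v mut psit ht, mut u = m0, mut v = m1 &
      (\int[mu]_(t in `[u, v]) (lagrangian (mut t) (psit t) (ht t))%:E
        <= (B ^+ 2 / (v - u))%:E)%E].

Lemma dirichlet_ge0 m psi : 0 <= dirichlet m psi.
Proof.
rewrite mulr_ge0 ?invr_ge0//; apply: sumr_ge0 => x _; apply: sumr_ge0 => y _.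
by do 2 (apply: mulr_ge0; last by []); apply: mulr_ge0; [exact: sqr_ge0|exact: logmean_ge0].
Qed.

Lemma lagrangian_ge0 m psi h : 0 <= lagrangian m psi h.
Proof. by rewrite addr_ge0// mulr_ge0// ?sqr_ge0// dirichlet_ge0. Qed.

Lemma fluxZ c m psi x : flux m (fun y => c * psi y) x = c * flux m psi x.
Proof.
by rewrite mulr_sumr; apply: eq_bigr => y _; rewrite -mulrBr !mulrA.
Qed.

Lemma dirichletZ c m psi : dirichlet m (fun y => c * psi y) = c ^+ 2 * dirichlet m psi.
Proof.
rewrite /dirichlet mulrCA; congr (_ * _); rewrite mulr_sumr; apply: eq_bigr => x _.
by rewrite mulr_sumr; apply: eq_bigr => y _; rewrite -mulrBr exprMn !mulrA.
Qed.

Lemma lagrangianZ c m psi h :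
  lagrangian m (fun y => c * psi y) (c * h) = c ^+ 2 * lagrangian m psi h.
Proof. by rewrite /lagrangian dirichletZ; ring. Qed.

Section measurability.
Context u v mut psit ht (curve : curve_on u v mut psit ht).

Lemma curve_measurable_mean x y :
  measurable_fun (`[u, v] : set R) (fun t => edge_mean (mut t) x y).
Proof.
apply: measurable_logmean => //.
- by move=> t tuv; exact: (curve_nonneg curve).
- by move=> t tuv; exact: (curve_nonneg curve).
- exact: absolutely_continuous_measurable (curve_abs_cont curve x).
- exact: absolutely_continuous_measurable (curve_abs_cont curve y).
Qed.

Lemma curve_measurable_edge x y : measurable_fun (`[u, v] : set R) (fun t =>
  (psit t y - psit t x) ^+ 2 * edge_mean (mut t) x y * K x y * w x).
Proof.
apply: measurable_funM; last exact: measurable_cst.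
apply: measurable_funM; last exact: measurable_cst.
apply: measurable_funM; last exact: curve_measurable_mean.
by apply: measurable_funX; apply: measurable_funB; exact: (curve_measurable_psi curve).
Qed.

Lemma curve_measurable_dirichlet :
  measurable_fun (`[u, v] : set R) (fun t => dirichlet (mut t) (psit t)).
Proof.
apply: measurable_funM; first exact: measurable_cst.
apply: measurable_sum => x; apply: measurable_sum => y; exact: curve_measurable_edge.
Qed.

Lemma curve_measurable_lagrangian :
  measurable_fun (`[u, v] : set R) (fun t => lagrangian (mut t) (psit t) (ht t)).
Proof.
apply: measurable_funD; apply: measurable_funM; try exact: measurable_cst.
- by apply: measurable_funX; exact: (curve_measurable_h curve).
- exact: curve_measurable_dirichlet.
Qed.

End measurability.

(** The velocity is multiplied by [c], and the equation is linear in the pair ([psit], [ht]) at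
    fixed density, so both are scaled by [c]. The sign of [c] is free: [c = -1] reverses a curve. *)
Lemma curve_affine c e u v u' v' mut psit ht : c != 0 ->
  (forall t, (t \in `[u', v']) = (c * t + e \in `[u, v])) ->
  curve_on u v mut psit ht ->
  curve_on u' v' (fun t => mut (c * t + e)) (fun t x => c * psit (c * t + e) x)
    (fun t => c * ht (c * t + e)).
Proof.
move=> c0 uvE curve.
have uvE' : `[u', v']%classic = [set t | `[u, v]%classic (c * t + e)].
  by apply/seteqP; split => t /=; rewrite uvE.
split.
- by move=> t; rewrite uvE; exact: (curve_nonneg curve).
- move=> x; apply: (absolutely_continuous_affine (f := mut^~ x) c0) (curve_abs_cont curve x).
  by move=> t; have := uvE t; rewrite !in_itv/= => ->.
- move=> x; apply: measurable_funM; first exact: measurable_cst.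
  rewrite uvE'; apply: (measurable_fun_affine (f := psit^~ x)) => //.
  exact: (curve_measurable_psi curve).
- apply: measurable_funM; first exact: measurable_cst.
  rewrite uvE'; apply: measurable_fun_affine => //.
  exact: (curve_measurable_h curve).
- have := ae_affine e c0 (curve_eq curve).
  apply: filterS; first exact: (ae_filter_ringOfSetsType mu).
  move=> t + tuv x; rewrite -uvE => /(_ tuv x) H.
  rewrite fluxZ -mulrA -mulrBr mulrC.
  apply: (is_derive1_comp (f := mut^~ x)) => //.
  apply: is_derive_eq; rewrite /GRing.scale /=; ring.
Qed.

Lemma lagrangian_affine c e u v u' v' mut psit ht B : c != 0 ->
  u < v -> v - u = `|c| * (v' - u') ->
  (forall t, (t \in `[u', v']) = (c * t + e \in `[u, v])) ->
  curve_on u v mut psit ht ->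
  (\int[mu]_(t in `[u, v]) (lagrangian (mut t) (psit t) (ht t))%:E
        <= (B ^+ 2 / (v - u))%:E)%E ->
  (\int[mu]_(t in `[u', v']) (lagrangian (mut (c * t + e)%R)
      (fun x => c * psit (c * t + e) x)%R (c * ht (c * t + e)%R))%:E
        <= (B ^+ 2 / (v' - u'))%:E)%E.
Proof.
move=> c0 uv vuE uvE curve.
have uvE' : `[u', v']%classic = [set t | `[u, v]%classic (c * t + e)].
  by apply/seteqP; split => t /=; rewrite uvE.
have mL := curve_measurable_lagrangian curve.
rewrite (ge0_integral_affine e c0)//; last 2 first.
- exact/measurable_EFinP.
- by move=> t _; rewrite lee_fin lagrangian_ge0.
rewrite -uvE'; under [X in _ -> (X <= _)%E]eq_integral do rewrite lagrangianZ EFinM.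
rewrite ge0_integralZl//; last 3 first.
- rewrite uvE'; apply/measurable_EFinP.
  exact: (measurable_fun_affine (f := fun t => lagrangian (mut t) (psit t) (ht t))).
- by move=> t _; rewrite lee_fin lagrangian_ge0.
- by rewrite lee_fin sqr_ge0.
set I := (\int[mu]_(_ in _) _)%E => IB.
have vu'0 : 0 < v' - u'.
  by rewrite -(pmulr_rgt0 _ (_ : 0 < `|c|)) ?normr_gt0// -vuE subr_gt0.
(* The lagrangian gains [c ^+ 2], and the substitution has already put one factor [|c|] in the
   hypothesis; the other is exactly the ratio of the two interval lengths. *)
have -> : ((c ^+ 2)%:E * I = `|c|%:E * (`|c|%:E * I))%E.
  by rewrite muleA -EFinM -normrM -expr2 ger0_norm ?sqr_ge0.
have -> : ((B ^+ 2 / (v' - u'))%:E = `|c|%:E * (B ^+ 2 / (v - u))%:E)%E.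
  by rewrite -EFinM vuE; congr EFin; field; rewrite normr_eq0 c0 gt_eqF.
by rewrite lee_pmul2l// ?fin_numE// lte_fin normr_gt0.
Qed.

Lemma reachable_rescale B u v u' v' m0 m1 : u < v -> u' < v' ->
  reachable B u v m0 m1 -> reachable B u' v' m0 m1.
Proof.
move=> uv uv' [mut [psit [ht [curve mu0 mv1 IB]]]].
have vu0 : 0 < v - u by rewrite subr_gt0.
have vu0' : 0 < v' - u' by rewrite subr_gt0.
pose c := (v - u) / (v' - u'); pose e := u - c * u'.
have c0 : 0 < c by rewrite divr_gt0.
have cE : v - u = c * (v' - u') by rewrite divfK// gt_eqF.
have cu : c * u' + e = u by rewrite /e addrC subrK.
have cv : c * v' + e = v by rewrite -[v](subrK u) cE /e; clear; ring.
have uvE t : (t \in `[u', v']) = (c * t + e \in `[u, v]).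
  by rewrite !in_itv/= -cu -cv !lerD2r !ler_pM2l.
exists (fun t => mut (c * t + e)), (fun t x => c * psit (c * t + e) x),
  (fun t => c * ht (c * t + e)); split; rewrite ?cu ?cv//.
- by apply: curve_affine curve => //; rewrite gt_eqF.
- by apply: lagrangian_affine uvE curve IB => //; rewrite ?gt_eqF// gtr0_norm.
Qed.

Lemma reachable_sym B u v m0 m1 : u < v ->
  reachable B u v m0 m1 -> reachable B u v m1 m0.
Proof.
move=> uv [mut [psit [ht [curve mu0 mv1 IB]]]].
have c0 : (-1 : R) != 0 by rewrite oppr_eq0 oner_eq0.
have uvE t : (t \in `[u, v]) = (-1 * t + (u + v) \in `[u, v]).
  by rewrite !in_itv/=; apply/idP/idP => /andP[h1 h2]; apply/andP; split;
    lra.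
exists (fun t => mut (-1 * t + (u + v))), (fun t x => -1 * psit (-1 * t + (u + v)) x),
  (fun t => -1 * ht (-1 * t + (u + v))); split.
- exact: curve_affine curve.
- by rewrite mulN1r addKr.
- by rewrite mulN1r addrC addrK.
- by apply: lagrangian_affine uvE curve IB => //; rewrite normrN1 mul1r.
Qed.

Lemma curve_glue u t0 v mut psit ht mut' psit' ht' : u <= t0 -> t0 <= v ->
  mut t0 = mut' t0 ->
  curve_on u t0 mut psit ht -> curve_on t0 v mut' psit' ht' ->
  curve_on u v (fun t => if t <= t0 then mut t else mut' t)
    (fun t => if t <= t0 then psit t else psit' t)
    (fun t => if t <= t0 then ht t else ht' t).
Proof.
move=> ut0 t0v mutE curve curve'.
have mglue (f g : R -> R) : measurable_fun (`[u, t0] : set R) f ->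
    measurable_fun (`[t0, v] : set R) g ->
    measurable_fun (`[u, v] : set R) (fun t => if t <= t0 then f t else g t).
  move=> mf mg; apply: measurable_fun_if => //.
  - by apply: measurable_fun_ler; [exact: measurable_id|exact: measurable_cst].
  - apply: measurable_funS mf => // t [] /=; rewrite !in_itv/= => /andP[-> _] ->//.
  - apply: measurable_funS mg => // t [] /=; rewrite !in_itv/= => /andP[_ ->].
    by rewrite andbT => /negbT; rewrite -ltNge => /ltW.
split.
- move=> t; rewrite in_itv/= => /andP[ut tv]; case: ifPn => tt0.
    by apply: (curve_nonneg curve); rewrite in_itv/= ut.
  by apply: (curve_nonneg curve'); rewrite in_itv/= tv andbT ltW// ltNge.
- move=> x.
  apply: (@eq_absolutely_continuous _ _ _ (fun t => if t <= t0 then mut t x else mut' t x)).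
    by move=> t _; case: ifP.
  apply: (absolutely_continuous_glue ut0 t0v (f := mut^~ x) (g := mut'^~ x)).
  + by rewrite mutE.
  + exact: (curve_abs_cont curve x).
  + exact: (curve_abs_cont curve' x).
- move=> x; rewrite (_ : (fun t => _) = fun t => if t <= t0 then psit t x else psit' t x).
    by apply: mglue;
      [exact: (curve_measurable_psi curve)|exact: (curve_measurable_psi curve')].
  by apply/funext => t; case: ifP.
- by apply: mglue; [exact: (curve_measurable_h curve)|exact: (curve_measurable_h curve')].
(* At the junction the two one-sided velocities may differ, so [t0] joins the null set; at any other
   time the glued curve coincides locally with one of the pieces. *)
- have : {ae mu, forall t, t != t0}.
    exists [set t0]; split => //; first exact: lebesgue_measure_set1.
    by move=> t /= /negP; rewrite negbK => /eqP.
  apply: filterS3 (curve_eq curve) (curve_eq curve').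
    exact: (ae_filter_ringOfSetsType mu).
  move=> t H H' tt0; rewrite in_itv/= => /andP[ut tv] x.
  move: H H' tt0; case: ltgtP => // tt0; rewrite !in_itv/= => H H' _.
  + apply: near_eq_is_derive (H _ x); last by rewrite ut ltW.
    by near=> s; rewrite ifT// ltW//; near: s; exact: lt_nbhsl.
  + apply: near_eq_is_derive (H' _ x); last by rewrite tv ltW.
    by near=> s; rewrite ifF//; apply/negbTE; rewrite -ltNge; near: s; exact: lt_nbhsr.
Unshelve. all: by end_near. Qed.

Lemma reachable_trans B B' u v m0 m1 m2 : 0 < B -> 0 < B' -> u < v ->
  reachable B u v m0 m1 -> reachable B' u v m1 m2 -> reachable (B + B') u v m0 m2.
Proof.
move=> B0 B'0 uv.
have BB0 : 0 < B + B' by rewrite addr_gt0.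
have vu0 : 0 < v - u by rewrite subr_gt0.
(* With time shares [B / (B + B')] and [B' / (B + B')] the two bounds add up to exactly
   [(B + B') ^+ 2 / (v - u)]. Positivity of both budgets keeps the subintervals nondegenerate. *)
have [t0 [ut0 t0v t0E t0E']] : exists t0, [/\ u < t0, t0 < v,
    B ^+ 2 / (t0 - u) = B * (B + B') / (v - u) &
    B' ^+ 2 / (v - t0) = B' * (B + B') / (v - u)].
  pose d := B / (B + B') * (v - u); pose d' := B' / (B + B') * (v - u).
  have d0 : 0 < d by rewrite mulr_gt0// divr_gt0.
  have d'0 : 0 < d' by rewrite mulr_gt0// divr_gt0.
  have dd' : v - (u + d) = d'.
    by rewrite /d /d'; field; rewrite gt_eqF.
  exists (u + d); split; first by rewrite ltrDl.
  - by rewrite -subr_gt0 dd'.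
  - by rewrite addrC addKr /d; field; rewrite !gt_eqF.
  - by rewrite dd' /d'; field; rewrite !gt_eqF.
move=> /(reachable_rescale uv ut0) [mut [psit [ht [curve mu0 mt1 IB]]]].
move=> /(reachable_rescale uv t0v) [mut' [psit' [ht' [curve' mt1' mv2 IB']]]].
have mutE : mut t0 = mut' t0 by rewrite mt1.
have glue := curve_glue (ltW ut0) (ltW t0v) mutE curve curve'.
have mL' := curve_measurable_lagrangian curve'.
do 3 eexists; split; first exact: glue; rewrite /=.
- by rewrite ltW.
- by rewrite leNgt t0v.
rewrite (_ : `[u, v]%classic = `[u, t0]%classic `|` `]t0, v]%classic); last first.
  apply/seteqP; split => t /=; rewrite !in_itv/=.
    by move=> /andP[-> ->]; case: leP => _; [left|right].
  move=> [/andP[-> h]|/andP[h ->]]; first by rewrite (le_trans h)// ltW.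
  by rewrite andbT ltW// (lt_trans ut0).
rewrite ge0_integral_setU//; last 3 first.
- apply/measurable_EFinP; apply: measurable_funS (curve_measurable_lagrangian glue) => //.
  by move=> t /= []; rewrite !in_itv/= => /andP[h1 h2];
    rewrite ?h1 ?h2 ?(le_trans h2 (ltW t0v)) ?(ltW (lt_trans ut0 h1)).
- by move=> t _; rewrite lee_fin lagrangian_ge0.
- rewrite disj_set2E; apply/eqP/seteqP; split => // t [] /=; rewrite !in_itv/=.
  by move=> /andP[_ /le_lt_trans h] /andP[/h]; rewrite ltxx.
have -> : (B + B') ^+ 2 / (v - u) = B ^+ 2 / (t0 - u) + B' ^+ 2 / (v - t0).
  by rewrite t0E t0E'; field; rewrite gt_eqF.
rewrite EFinD; apply: leeD.
- apply: le_trans IB; rewrite le_eqVlt; apply/orP; left; apply/eqP.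
  by apply: eq_integral => t; rewrite inE/= in_itv/= => /andP[_ ->].
- apply: le_trans IB'; rewrite le_eqVlt; apply/orP; left; apply/eqP.
  rewrite -integral_itv_obnd_cbnd; last first.
    by apply/measurable_EFinP/measurable_fun_itv_obnd_cbndP.
  by apply: eq_integral => t; rewrite inE/= in_itv/= => /andP[h _]; rewrite leNgt h.
Qed.

End reachability.

(** * The weighted graph Laplacian *)

Section weighted_laplacian.
Context {R : realType}.

(** Summation by parts: exchanging [x] and [y] under a symmetric [c] rewrites the right-hand sum
    with [psi y] in place of [psi x], up to sign. *)
Lemma sum_conductance_sqr {X : finType} (c : X -> X -> R) (psi : X -> R) :
  (forall x y, c x y = c y x) ->
  2^-1 * \sum_x \sum_y (psi y - psi x) ^+ 2 * c x y =
  - \sum_x psi x * \sum_y (psi y - psi x) * c x y.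
Proof.
move=> csym.
set A := \sum_x psi x * _.
have -> : \sum_x \sum_y (psi y - psi x) ^+ 2 * c x y = - A - A; last by field.
have {1}-> : A = - \sum_x \sum_y psi y * ((psi y - psi x) * c x y).
  rewrite exchange_big -sumrN; apply: eq_bigr => x _; rewrite -sumrN mulr_sumr.
  by apply: eq_bigr => y _; rewrite csym; ring.
rewrite opprK /A -sumrB; apply: eq_bigr => x _; rewrite mulr_sumr -sumrB.
by apply: eq_bigr => y _; ring.
Qed.

(* The rank-one shift by the all-ones matrix removes the kernel of the graph
   Laplacian without changing the solution for right-hand sides of sum zero. *)
Let shifted_laplacian n (c : 'I_n -> 'I_n -> R) : 'M[R]_n :=
  \matrix_(i, j) ((i == j)%:R * (\sum_k c i k) - c i j + 1).

Let mul_shifted_laplacian n (c : 'I_n -> 'I_n -> R) (v : 'rV_n) j :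
  (forall i k, c i k = c k i) ->
  (v *m shifted_laplacian c) 0 j =
  \sum_k v 0 k - \sum_k (v 0 k - v 0 j) * c j k.
Proof.
move=> csym; rewrite mxE.
under eq_bigr do rewrite !mxE mulrDr mulr1.
rewrite big_split /= addrC; congr (_ + _).
under eq_bigr do rewrite mulrBr mulrCA mulrA.
rewrite sumrB (bigD1 j)//= eqxx mul1r [X in _ + X - _]big1 ?addr0; last first.
  by move=> i /negbTE ->; rewrite !mul0r.
rewrite mulr_sumr -sumrB -sumrN; apply: eq_bigr => k _.
by rewrite [c k j]csym; ring.
Qed.

(** Pairing a null vector [v] with its own equation gives the square of its sum plus its energy
    equal to [0]. Both vanish, so [v] is constant with sum zero. *)
Let shifted_laplacian_unit n (c : 'I_n -> 'I_n -> R) :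
  (forall i j, c i j = c j i) -> (forall i j, 0 <= c i j) ->
  (forall psi : 'I_n -> R, \sum_i \sum_j (psi j - psi i) ^+ 2 * c i j = 0 ->
    forall i j, psi i = psi j) ->
  shifted_laplacian c \in unitmx.
Proof.
move=> csym c0 conn; rewrite unitmxE unitfE; apply/negP => /det0P [v v0 vM].
pose E := \sum_i \sum_j (v 0 j - v 0 i) ^+ 2 * c i j.
have E0 : 0 <= E.
  by apply: sumr_ge0 => i _; apply: sumr_ge0 => j _; rewrite mulr_ge0// sqr_ge0.
have : (\sum_k v 0 k) ^+ 2 + 2^-1 * E = 0.
  rewrite sum_conductance_sqr// expr2 mulr_suml -sumrB big1// => j _.
  rewrite -mulrBr -mul_shifted_laplacian// vM mxE mulr0 //.
move/eqP; rewrite paddr_eq0 ?sqr_ge0// ?mulr_ge0// => /andP[/eqP sv0 /eqP Eh].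
have /conn vconst : E = 0.
  by apply/eqP; rewrite -(mulrI_eq0 _ (lregP (_ : 2^-1 != 0 :> R))) ?Eh ?invr_eq0 ?pnatr_eq0.
move/negP: v0; apply; apply/eqP/rowP => j; rewrite mxE.
have : (\sum_k v 0 k) = v 0 j *+ n.
  rewrite (eq_bigr (fun=> v 0 j)); last by move=> k _; exact: vconst.
  by rewrite sumr_const card_ord.
move/eqP: sv0; rewrite sqrf_eq0 => /eqP -> /esym/eqP.
rewrite mulrn_eq0 => /orP[n0|/eqP //].
by have := leq_ltn_trans (leq0n _) (ltn_ord j); rewrite lt0n n0.
Qed.

Section measurable_matrix.
Context d (T : measurableType d) (D : set T).

Lemma measurable_determinant n (A : T -> 'M[R]_n) :
  (forall i j, measurable_fun D (fun t => A t i j)) ->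
  measurable_fun D (fun t => \det (A t)).
Proof.
move=> mA; apply: measurable_sum => s; apply: measurable_funM => //.
exact: measurable_prod.
Qed.

(** By the cofactor formula the entries of the inverse are rational functions of the entries of the
    matrix. *)
Lemma measurable_invmx n (A : T -> 'M[R]_n) i j :
  (forall t, D t -> A t \in unitmx) ->
  (forall i j, measurable_fun D (fun t => A t i j)) ->
  measurable_fun D (fun t => invmx (A t) i j).
Proof.
move=> uA mA.
apply: (@eq_measurable_fun _ _ _ _ D (fun t => (\det (A t))^-1 * cofactor (A t) j i)).
  by move=> t /set_mem Dt; rewrite /invmx uA// !mxE.
apply: measurable_funM; first by apply: measurable_funVr; exact: measurable_determinant.
apply: measurable_funM => //; apply: measurable_determinant => k l.
by under eq_fun do rewrite !mxE; exact: mA.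
Qed.

(** An admissible potential must be measurable in time, so it is computed by the inverse of the
    shifted Laplacian and not chosen separately at each time. *)
Lemma measurable_poisson_solution (X : finType) (c : T -> X -> X -> R)
    (r : T -> X -> R) :
  (forall x y, measurable_fun D (fun t => c t x y)) ->
  (forall x, measurable_fun D (r^~ x)) ->
  (forall t, D t -> forall x y, c t x y = c t y x) ->
  (forall t, D t -> forall x y, 0 <= c t x y) ->
  (forall t, D t -> forall psi : X -> R,
    \sum_x \sum_y (psi y - psi x) ^+ 2 * c t x y = 0 -> forall x y, psi x = psi y) ->
  (forall t, D t -> \sum_x r t x = 0) ->
  exists2 psi : T -> X -> R, forall x, measurable_fun D (psi^~ x) &
    forall t, D t -> forall x, \sum_y (psi t y - psi t x) * c t x y = r t x.
Proof.
move=> mc mr csym c0 conn r0.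
pose c' t (i j : 'I_#|X|) := c t (enum_val i) (enum_val j).
pose M t := shifted_laplacian (c' t).
pose rv t : 'rV[R]_#|X| := \row_i - r t (enum_val i).
have sumX (F : X -> R) : \sum_x F x = \sum_(i < #|X|) F (enum_val i).
  by rewrite (reindex (@enum_val X predT))//; apply: onW_bij; exact: enum_val_bij.
have csym' t : D t -> forall i j, c' t i j = c' t j i.
  by move=> Dt i j; exact: csym.
have uM t : D t -> M t \in unitmx.
  move=> Dt; apply: shifted_laplacian_unit.
  - exact: csym'.
  - by move=> i j; exact: c0.
  - move=> psi E0 i j.
    have := conn t Dt (fun x => psi (enum_rank x)).
    move=> /(_ _ (enum_val i) (enum_val j)); rewrite !enum_valK; apply.
    rewrite sumX -[RHS]E0; apply: eq_bigr => k _; rewrite sumX.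
    by apply: eq_bigr => l _; rewrite !enum_valK.
have mM i j : measurable_fun D (fun t => M t i j).
  under eq_fun do rewrite mxE.
  apply: measurable_funD => //; apply: measurable_funB; last exact: mc.
  by apply: measurable_funM => //; apply: measurable_sum => k; exact: mc.
exists (fun t x => (rv t *m invmx (M t)) 0 (enum_rank x)).
  move=> x; under eq_fun do rewrite mxE.
  apply: measurable_sum => i; apply: measurable_funM; last exact: measurable_invmx.
  under eq_fun do rewrite mxE.
  by apply: measurable_funN; exact: mr.
move=> t Dt x; set v := rv t *m invmx (M t).
have vM j : \sum_k v 0 k - \sum_k (v 0 k - v 0 j) * c' t j k = - r t (enum_val j).
  by rewrite -mul_shifted_laplacian ?mulmxKV ?uM ?mxE//; exact: csym'.
(* Summing all equations cancels the Laplacian part by antisymmetry and the right-hand side by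
   hypothesis; only the number of points times the sum of [v] remains. So the shift contributes
   nothing. *)
have sv0 : \sum_k v 0 k = 0.
  have : \sum_j (\sum_k v 0 k - \sum_k (v 0 k - v 0 j) * c' t j k) = 0.
    under eq_bigr do rewrite vM.
    by rewrite sumrN -sumX r0 ?oppr0.
  rewrite sumrB sumr_const card_ord.
  have -> : \sum_(i < #|X|) \sum_k (v 0 k - v 0 i) * c' t i k = 0.
    set S := (LHS); suff : S = - S by lra.
    rewrite {1}/S exchange_big -sumrN; apply: eq_bigr => i _; rewrite -sumrN.
    by apply: eq_bigr => j _; rewrite csym'//; ring.
  rewrite subr0 => /eqP; rewrite mulrn_eq0 => /orP[X0|/eqP //].
  rewrite big1// => i _.
  by have := leq_ltn_trans (leq0n _) (ltn_ord i); rewrite lt0n X0.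
have := vM (enum_rank x); rewrite sv0 sub0r enum_rankK => /oppr_inj <-.
rewrite sumX; apply: eq_bigr => k _.
by rewrite /c' enum_valK enum_rankK.
Qed.

End measurable_matrix.
End weighted_laplacian.

(** * Dirichlet form of a reversible kernel: Poincare inequality and flux bound *)

Section reversible_kernel.
Context {R : realType} {X : finType} (K : X -> X -> R) (w p : X -> R) (a b : R).
Context (K_markov : markov_kernel K) (K_irreducible : irreducible_kernel K).
Context (w_steady : steady_state K w) (w_reversible : reversible K w).
Context (p_gt0 : forall x, 0 < p x) (p_norm1 : norm1 w p = 1).
Implicit Types (m psi : X -> R).

Let K_ge0 x y : 0 <= K x y. Proof. by case: K_markov. Qed.
Let w_ge0 x : 0 <= w x. Proof. by case: w_steady. Qed.

Lemma kernel_iter_ge0 n x y : 0 <= kernel_iter K n x y.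
Proof.
elim: n x => [|n IH] x /=; first by rewrite ler0n.
by apply: sumr_ge0 => z _; rewrite mulr_ge0.
Qed.

Lemma steady_state_iter n y : w y = \sum_x w x * kernel_iter K n x y.
Proof.
elim: n => [|n IH] /=.
  rewrite (bigD1 y)//= eqxx mulr1 big1 ?addr0// => x /negbTE ->.
  by rewrite mulr0.
rewrite IH; under [RHS]eq_bigr do rewrite mulr_sumr.
rewrite exchange_big /=; apply: eq_bigr => z _.
have [_ _ {1}->] := w_steady; rewrite mulr_suml.
by apply: eq_bigr => x _; rewrite mulrA.
Qed.

(** Some point carries mass, and invariance under an iterate of the kernel that joins it to [x]
    carries part of that mass to [x]. *)
Lemma steady_state_gt0 x : 0 < w x.
Proof.
have [x0 w0] : exists x0, 0 < w x0.
  apply: contrapT => /forallNP w0.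
  have [_ + _] := w_steady; rewrite big1; first by move/eqP; rewrite eq_sym oner_eq0.
  by move=> y _; apply/eqP; rewrite eq_le w_ge0 andbT leNgt; apply/negP/w0.
have [n Kn] := K_irreducible x0 x.
rewrite (steady_state_iter n) (bigD1 x0)//= ltr_pwDl ?mulr_gt0//.
by apply: sumr_ge0 => y _; rewrite mulr_ge0// kernel_iter_ge0.
Qed.

Let w_gt0 := steady_state_gt0.

Lemma sum_weight_p : \sum_x w x * p x = 1.
Proof. by rewrite -p_norm1; apply: eq_bigr => x _; rewrite gtr0_norm. Qed.

(** The Dirichlet form at the constant density [1], where the edge mean is [1]. *)
Let energy1 psi := 2^-1 * \sum_x \sum_y (psi y - psi x) ^+ 2 * K x y * w x.

Let edge_ge0 psi x y : 0 <= (psi y - psi x) ^+ 2 * K x y * w x.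
Proof. by do 2 (apply: mulr_ge0; last by []); exact: sqr_ge0. Qed.

Let energy1_ge0 psi : 0 <= energy1 psi.
Proof.
by rewrite mulr_ge0// sumr_ge0// => x _; rewrite sumr_ge0.
Qed.

Let edge_le_energy1 psi x y :
  (psi y - psi x) ^+ 2 * K x y * w x <= 2 * energy1 psi.
Proof.
rewrite mulrA divff ?pnatr_eq0// mul1r (bigD1 x)//= (bigD1 y)//= -addrA lerDl.
rewrite addr_ge0//; apply: sumr_ge0 => z _; first exact: edge_ge0.
by apply: sumr_ge0 => ? _; exact: edge_ge0.
Qed.

(** A positive iterate yields a path of positive transitions from [x] to [y]; the potential
    difference telescopes along it, each edge being controlled by the energy. *)
Let poincare_path n x y : 0 < kernel_iter K n x y ->
  exists C, forall psi, (psi y - psi x) ^+ 2 <= C * energy1 psi.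
Proof.
elim: n x => [|n IH] x /=.
  case: eqVneq => [->|]; last by rewrite ltxx.
  by exists 0 => psi; rewrite subrr expr0n mul0r.
move=> sum_gt0; have [z Kz] : exists z, 0 < K x z * kernel_iter K n z y.
  apply: contrapT => /forallNP H; move: sum_gt0; rewrite ltNge => /negP; apply.
  by apply: sumr_le0 => z _; rewrite leNgt; apply/negP/H.
have Kxz : 0 < K x z.
  rewrite lt_neqAle K_ge0 andbT; apply: contraTneq Kz => <-.
  by rewrite mul0r ltxx.
have [C HC] : exists C, forall psi, (psi y - psi z) ^+ 2 <= C * energy1 psi.
  by apply: IH; rewrite -(pmulr_rgt0 _ Kxz).
have Kw : 0 < K x z * w x by rewrite mulr_gt0.
(* Factors [2] come from [(A + B)^2 <= 2 A^2 + 2 B^2]; the edge term gets a second one from the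
   [2^-1] in the energy. *)
exists (2 * C + 4 / (K x z * w x)) => psi.
have h1 := HC psi; have h2 := edge_le_energy1 psi x z.
rewrite -mulrA -ler_pdivlMr// in h2.
have -> : psi y - psi x = (psi y - psi z) + (psi z - psi x) by ring.
set A := psi y - psi z in h1 *; set B := psi z - psi x in h2 *.
have AB : (A + B) ^+ 2 <= 2 * A ^+ 2 + 2 * B ^+ 2.
  by rewrite -subr_ge0 (_ : _ - _ = (A - B) ^+ 2) ?sqr_ge0//; ring.
apply: le_trans AB _; rewrite [leRHS]mulrDl lerD//.
  by rewrite -mulrA ler_pM2l.
rewrite (_ : 4 / _ * _ = 2 * (2 * energy1 psi / (K x z * w x))) ?ler_pM2l//.
by ring.
Qed.

Let poincare : exists2 C, 0 <= C &
  forall psi x y, (psi y - psi x) ^+ 2 <= C * energy1 psi.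
Proof.
have /choice [C HC] : forall xy : X * X, exists C,
    forall psi, (psi xy.2 - psi xy.1) ^+ 2 <= C * energy1 psi.
  move=> [x y] /=; have [n] := K_irreducible x y; exact: poincare_path.
exists (\sum_xy `|C xy|); first by apply: sumr_ge0.
move=> psi x y; rewrite (le_trans (HC (x, y) psi))// ler_wpM2r//.
by rewrite (le_trans (ler_norm _))// (bigD1 (x, y))//= lerDl sumr_ge0.
Qed.

Lemma edge_mean_conductanceC m x y : (forall z, 0 <= m z) ->
  edge_mean m x y * K x y * w x = edge_mean m y x * K y x * w y.
Proof.
by move=> m0; rewrite -!mulrA w_reversible /edge_mean logmeanC.
Qed.

Lemma dirichlet_flux m psi : (forall z, 0 <= m z) ->
  dirichlet K w m psi = - \sum_x psi x * (w x * flux K m psi x).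
Proof.
move=> m0; have := sum_conductance_sqr psi (fun x y => edge_mean_conductanceC x y m0).
set A := 2^-1 * _; set B := - _ => AB.
transitivity A.
  by congr (_ * _); apply: eq_bigr => x _; apply: eq_bigr => y _; rewrite !mulrA.
rewrite AB /B; congr (- _); apply: eq_bigr => x _; congr (_ * _).
rewrite mulr_sumr; apply: eq_bigr => y _; ring.
Qed.

(** Detailed balance makes each weighted edge term antisymmetric in [x] and [y]. *)
Lemma sum_flux m psi : (forall z, 0 <= m z) -> \sum_x w x * flux K m psi x = 0.
Proof.
move=> m0; set S := (LHS); suff : S = - S by lra.
have -> : S = \sum_x \sum_y (psi y - psi x) * (edge_mean m x y * K x y * w x).
  by apply: eq_bigr => x _; rewrite mulr_sumr; apply: eq_bigr => y _; ring.
rewrite {1}exchange_big -sumrN; apply: eq_bigr => x _; rewrite -sumrN.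
by apply: eq_bigr => y _; rewrite edge_mean_conductanceC//; ring.
Qed.

(** Where [m >= c] every edge mean is at least [c], so the form dominates [c] times [energy1]. The
    constant [C] does not depend on [c] or [m]. *)
Lemma dirichlet_spectral_gap : exists2 C, 0 <= C &
  forall c m psi, 0 < c -> (forall x, c <= m x) ->
    forall x y, (psi y - psi x) ^+ 2 <= C / c * dirichlet K w m psi.
Proof.
have [C C0 HC] := poincare; exists C => // c m psi c0 cm x y.
rewrite (le_trans (HC psi x y))// -mulrA ler_wpM2l// mulrC ler_pdivlMr// mulrC.
rewrite /energy1 mulrCA ler_wpM2l// mulr_sumr; apply: ler_sum => u _.
rewrite mulr_sumr; apply: ler_sum => v _.
move: (sqr_ge0 (psi v - psi u)); move: ((psi v - psi u) ^+ 2) => q q0.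
rewrite -!mulrA mulrCA ler_wpM2l// ler_wpM2r ?mulr_ge0//.
exact: logmean_ge.
Qed.

(** The energy is the pairing of the potential with its flux, hence at most the oscillation of the
    potential times the l^1 norm of the flux. The spectral gap bounds that oscillation by the square
    root of the energy; squaring and dividing by the energy concludes. *)
Lemma dirichlet_le_flux : exists2 C, 0 <= C &
  forall c m psi, 0 < c -> (forall x, c <= m x) ->
    dirichlet K w m psi <= C / c * (\sum_x w x * `|flux K m psi x|) ^+ 2.
Proof.
have [C C0 HC] := dirichlet_spectral_gap; exists C => // c m psi c0 cm.
have m0 z : 0 <= m z by exact: le_trans (ltW c0) (cm z).
set S := \sum_x _; pose E := dirichlet K w m psi.
have S0 : 0 <= S by apply: sumr_ge0 => x _; rewrite mulr_ge0.
have E0 : 0 <= E by exact: dirichlet_ge0.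
have [->|En0] := eqVneq (dirichlet K w m psi) 0.
  by rewrite mulr_ge0 ?sqr_ge0// divr_ge0// ltW.
have Egt0 : 0 < E by rewrite lt_neqAle eq_sym En0.
have [x0 _|X0] := pickP (@predT X); last first.
  by move: En0; rewrite /dirichlet big1 ?mulr0 ?eqxx// => x; have := X0 x.
have CE0 : 0 <= C / c * E by rewrite mulr_ge0// divr_ge0// ltW.
have ES : E <= Num.sqrt (C / c * E) * S.
  (* Since the flux has total zero, the potential can be normalized at [x0], which leaves only
     differences. *)
  have {1}-> : E = - \sum_x (psi x - psi x0) * (w x * flux K m psi x).
    rewrite /E dirichlet_flux//; congr (- _).
    under [RHS]eq_bigr do rewrite mulrBl.
    by rewrite sumrB -mulr_sumr sum_flux// mulr0 subr0.
  rewrite -sumrN mulr_sumr; apply: ler_sum => x _.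
  rewrite (le_trans (ler_norm _))// normrN normrM normrM (ger0_norm (w_ge0 x)).
  rewrite ler_wpM2r ?mulr_ge0//.
  by rewrite -sqrtr_sqr ler_wsqrtr//; exact: (HC c m psi c0 cm x0 x).
have E2 : E ^+ 2 <= (Num.sqrt (C / c * E) * S) ^+ 2.
  by rewrite lerXn2r ?nnegrE// mulr_ge0// sqrtr_ge0.
rewrite [leRHS]exprMn sqr_sqrtr// in E2.
by rewrite -/E -(ler_pM2r Egt0) -expr2 (le_trans E2)// mulrAC.
Qed.

End reversible_kernel.

(** * Upper bounds for the distance *)

Section upper_bound.
Context {R : realType} {X : finType} (K : X -> X -> R) (w p : X -> R) (a b : R).
Context (K_markov : markov_kernel K) (K_irreducible : irreducible_kernel K).
Context (w_steady : steady_state K w) (w_reversible : reversible K w).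
Context (p_gt0 : forall x, 0 < p x) (p_norm1 : norm1 w p = 1).
Context (a_gt0 : 0 < a).
Implicit Types (m psi l : X -> R).
Local Notation mu := (@lebesgue_measure R).
Local Notation reach B := (reachable K w p a b B 0 1).

Let K_ge0 x y : 0 <= K x y. Proof. by case: K_markov. Qed.
Let w_ge0 x : 0 <= w x. Proof. by case: w_steady. Qed.
Let w_gt0 : forall x, 0 < w x := steady_state_gt0 K_markov K_irreducible w_steady.

Lemma reachable_of_bound B mut psit ht : curve_on K p 0 1 mut psit ht ->
  (forall t, t \in `[0, 1] ->
    lagrangian K w a b (mut t) (psit t) (ht t) <= B ^+ 2) ->
  reach B (mut 0) (mut 1).
Proof.
move=> curve LB; exists mut, psit, ht; split => //.
rewrite subr0 divr1.
have -> : (B ^+ 2)%:E = (\int[mu]_(t in `[0%R, 1%R]) (cst (B ^+ 2)%:E) t)%E.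
  by rewrite integral_cst//= lebesgue_measure_itv/= lte01 sube0 mule1.
apply: ge0_le_integral => //.
- by move=> t _; rewrite lee_fin lagrangian_ge0.
- by apply/measurable_EFinP; exact: curve_measurable_lagrangian curve.
Qed.

Lemma reachable_le B B' u v m m' : 0 <= B -> B <= B' -> u < v ->
  reachable K w p a b B u v m m' -> reachable K w p a b B' u v m m'.
Proof.
move=> B0 BB' uv [mut [psit [ht [? ? ? IB]]]]; exists mut, psit, ht; split => //.
apply: le_trans IB _; rewrite lee_fin ler_pM2r ?invr_gt0 ?subr_gt0//.
by rewrite lerXn2r ?nnegrE// (le_trans B0).
Qed.

Lemma is_derive_affine (c d t : R) : is_derive t 1 (fun s => c + s * d) d.
Proof.
apply: is_derive_eq; rewrite /GRing.scale /=; ring.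
Qed.

Lemma absolutely_continuous_affine_fun (u v c d : R) :
  absolutely_continuous u v (fun s => c + s * d).
Proof.
apply: (@absolutely_continuous_lipschitz _ _ _ `|d|) => x y xy.
rewrite (_ : _ - _ = d * (y - x)); last by ring.
by rewrite normrM [`|y - x|]ger0_norm// subr_ge0.
Qed.

Lemma reachable_raise m s : nonneg_densities m -> 0 <= s ->
  reach (a * s) m (fun x => m x + s * p x).
Proof.
move=> m0 s0.
pose mut t x := m x + t * (s * p x).
have mut0E : mut 0 = m by apply/funext => x; rewrite /mut mul0r addr0.
have mut1E : mut 1 = fun x => m x + s * p x.
  by apply/funext => x; rewrite /mut mul1r.
suff : reach (a * s) (mut 0) (mut 1) by rewrite mut0E mut1E.
have flux0 m' x : flux K m' (cst 0) x = 0.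
  by apply: big1 => y _; rewrite subrr !mul0r.
apply: (@reachable_of_bound _ _ (fun _ => cst 0) (fun _ => s)).
  split => //.
  - move=> t; rewrite in_itv/= => /andP[t0 _] x.
    by rewrite addr_ge0// ?m0// !mulr_ge0// ltW.
  - by move=> x; exact: absolutely_continuous_affine_fun.
  - apply: aeW => t _ x; rewrite flux0 subr0; exact: is_derive_affine.
move=> t _; rewrite /lagrangian /dirichlet big1 ?mulr0 ?addr0 ?exprMn//.
by move=> x _; apply: big1 => y _; rewrite subrr expr0n !mul0r.
Qed.

Lemma reachable_interpolation c : 0 < c -> exists2 G, 0 < G &
  forall m m', (forall x, c <= m x) -> (forall x, c <= m' x) ->
    reach (G * \sum_x w x * `|m' x - m x|) m m'.
Proof.
move=> c0; have [C C0 HC] := dirichlet_le_flux K_markov K_irreducible w_steady w_reversible.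
have Cc0 : 0 <= C / c by rewrite divr_ge0// ltW.
(* The lagrangian is at most [G0 * delta ^+ 2]: the mass rate satisfies [|h| <= delta], and the [4]
   is the square in [(2 * delta) ^+ 2], a bound for the squared l^1 norm of the flux [r]. *)
pose G0 := a ^+ 2 + b ^+ 2 * (C / c) * 4.
have G00 : 0 <= G0.
  by rewrite addr_ge0 ?sqr_ge0// mulr_ge0// mulr_ge0 ?sqr_ge0.
exists (1 + G0); first by rewrite ltr_pwDl.
move=> m m' cm cm'.
pose D x := m' x - m x; pose delta := \sum_x w x * `|D x|.
(* Since [p] has weighted mass [1], creating mass at rate [h] accounts for the whole change of mass;
   the remainder [r] has weighted sum zero, which makes the Poisson equation solvable. *)
pose h := \sum_x w x * D x; pose r x := h * p x - D x.
pose mut t x := m x + t * D x.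
have cmut t : t \in `[0, 1] -> forall x, c <= mut t x.
  rewrite in_itv/= => /andP[t0 t1] x; have h1 := cm x; have h2 := cm' x.
  have -> : mut t x = (1 - t) * m x + t * m' x by rewrite /mut /D; ring.
  have -> : c = (1 - t) * c + t * c by ring.
  by rewrite lerD// ler_wpM2l// subr_ge0.
have mut0 t : t \in `[0, 1] -> forall x, 0 <= mut t x.
  by move=> t01 x; exact: le_trans (ltW c0) (cmut t t01 x).
have mmut x : measurable_fun (`[0, 1] : set R) (mut^~ x).
  exact: absolutely_continuous_measurable (absolutely_continuous_affine_fun _ _ _ _).
have sumr : \sum_x w x * r x = 0.
  rewrite /r; under eq_bigr do rewrite mulrBr mulrCA.
  by rewrite sumrB -mulr_sumr sum_weight_p// mulr1 subrr.
have [psi mpsi psiE] : exists2 psi : R -> X -> R,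
    forall x, measurable_fun (`[0, 1] : set R) (psi^~ x) &
    forall t, t \in `[0, 1] -> forall x, flux K (mut t) (psi t) x = r x.
  have [| | | | | |psi mpsi psiE] := @measurable_poisson_solution R _
    (measurableTypeR R) `[0, 1]%classic X
    (fun t x y => edge_mean (mut t) x y * K x y * w x) (fun t x => w x * r x).
  - move=> x y; do 2 (apply: measurable_funM; last exact: measurable_cst).
    apply: measurable_logmean; [by []| | |exact: mmut|exact: mmut].
    + by move=> t t01; exact: (mut0 t t01).
    + by move=> t t01; exact: (mut0 t t01).
  - by move=> x; exact: measurable_cst.
  - by move=> t t01 x y; apply: edge_mean_conductanceC => //; exact: (mut0 t t01).
  - move=> t t01 x y; rewrite mulr_ge0// mulr_ge0//; exact: logmean_ge0.
  (* Zero energy forces a constant potential by the spectral gap, available because the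
     interpolation stays above [c]. *)
  - move=> t t01 psi E0 x y.
    have [C' C'0 HC'] := dirichlet_spectral_gap K_markov K_irreducible w_steady.
    have := HC' c (mut t) psi c0 (cmut t t01) y x.
    rewrite (_ : dirichlet _ _ _ _ = 0) ?mulr0; last first.
      rewrite /dirichlet -[RHS](mulr0 2^-1); congr (_ * _); rewrite -[RHS]E0.
      by apply: eq_bigr => u _; apply: eq_bigr => v _; rewrite !mulrA.
    by rewrite real_exprn_even_le0 ?num_real//= subr_eq0 => /eqP.
  - by [].
  - exists psi => // t t01 x; apply: (mulfI (lt0r_neq0 (w_gt0 x))).
    rewrite -(psiE t t01 x) mulr_sumr; apply: eq_bigr => y _; ring.
have mut0E : mut 0 = m by apply/funext => x; rewrite /mut mul0r addr0.
have mut1E : mut 1 = m' by apply/funext => x; rewrite /mut mul1r /D addrC subrK.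
suff : reach ((1 + G0) * delta) (mut 0) (mut 1) by rewrite mut0E mut1E.
apply: (@reachable_of_bound _ _ psi (fun _ => h)).
  split => //.
  - by move=> x; exact: absolutely_continuous_affine_fun.
  - apply: aeW => t t01 x; rewrite psiE// /r subKr; exact: is_derive_affine.
move=> t t01.
have delta0 : 0 <= delta by apply: sumr_ge0 => x _; rewrite mulr_ge0.
have hdelta : `|h| <= delta.
  rewrite (le_trans (ler_norm_sum _ _ _))//; apply: ler_sum => x _.
  by rewrite normrM ger0_norm.
have rdelta : \sum_x w x * `|r x| <= 2 * delta.
  apply: (@le_trans _ _ (\sum_x (`|h| * (w x * p x) + w x * `|D x|))).
    apply: ler_sum => x _; rewrite mulrCA -mulrDr ler_wpM2l//.
    by rewrite (le_trans (ler_normB _ _))// normrM (gtr0_norm (p_gt0 x)).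
  by rewrite big_split /= -mulr_sumr sum_weight_p// mulr1 mulrDl mul1r lerD2r.
have E_le : dirichlet K w (mut t) (psi t) <= C / c * (2 * delta) ^+ 2.
  rewrite (le_trans (HC c _ _ c0 (cmut t t01)))// ler_wpM2l//.
  rewrite lerXn2r ?nnegrE ?mulr_ge0//; first by apply: sumr_ge0 => x _; rewrite mulr_ge0.
  rewrite (eq_bigr (fun x => w x * `|r x|))// => x _; first by rewrite psiE.
have h2 : h ^+ 2 <= delta ^+ 2 by rewrite -real_normK ?num_real// lerXn2r ?nnegrE.
apply: (@le_trans _ _ (G0 * delta ^+ 2)).
  rewrite /lagrangian /G0 mulrDl lerD// ?ler_wpM2l ?sqr_ge0//.
  rewrite (_ : _ * delta ^+ 2 = b ^+ 2 * (C / c * (2 * delta) ^+ 2)); last by ring.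
  by rewrite ler_wpM2l ?sqr_ge0.
rewrite exprMn ler_wpM2r ?sqr_ge0//.
(* [1 + G0] serves as a positive constant whose square exceeds [G0], avoiding a square root. *)
rewrite -subr_ge0 (_ : _ - _ = 1 + G0 + G0 ^+ 2); last by ring.
by rewrite addr_ge0 ?sqr_ge0// addr_ge0.
Qed.

(** The detour goes through [m + s p] and [l + s p], both at least [s * c] and with the same
    difference as [m] and [l]. The extra [e] keeps the middle budget positive, as concatenation
    requires, even when [m = l]. *)
Lemma reachable_estimate s e : 0 < s -> 0 < e -> exists2 G, 0 < G &
  forall m l, nonneg_densities m -> nonneg_densities l ->
    reach (a * s + (G * (\sum_x w x * `|l x - m x|) + e) + a * s) m l.
Proof.
move=> s0 e0; pose c := \big[Num.min/1]_x p x.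
have c0 : 0 < c by exact: lt_bigmin.
have sc0 : 0 < s * c by rewrite mulr_gt0.
have [G G0 HG] := reachable_interpolation sc0; exists G => // m l m0 l0.
have raise_ge f : nonneg_densities f -> forall x, s * c <= f x + s * p x.
  move=> f0 x; rewrite (@le_trans _ _ (s * p x)) ?lerDr// ler_pM2l//.
  exact: bigmin_le.
have as0 : 0 < a * s by rewrite mulr_gt0.
have G_ge0 : 0 <= G * \sum_x w x * `|l x - m x|.
  by rewrite mulr_ge0 ?(ltW G0)//; apply: sumr_ge0 => x _; rewrite mulr_ge0.
have Ge0 : 0 < G * (\sum_x w x * `|l x - m x|) + e by rewrite ltr_wpDl.
apply: (@reachable_trans _ _ _ _ _ _ _ _ _ _ _ _ _ _ (fun x => l x + s * p x)) => //.
- by rewrite addr_gt0.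
- apply: (@reachable_trans _ _ _ _ _ _ _ _ _ _ _ _ _ _ (fun x => m x + s * p x)) => //.
    exact: reachable_raise (ltW s0).
  apply: (reachable_le G_ge0) => //; first by rewrite lerDl ltW.
  have := HG _ _ (raise_ge m m0) (raise_ge l l0).
  by under eq_bigr do rewrite opprD addrACA subrr addr0.
- by apply: reachable_sym => //; exact: reachable_raise (ltW s0).
Qed.

Lemma reachable_near e : 0 < e -> exists2 d, 0 < d &
  forall m l, nonneg_densities m -> nonneg_densities l ->
    \sum_x w x * `|l x - m x| < d -> reach e m l.
Proof.
move=> e0; have e40 : 0 < e / 4 by rewrite divr_gt0.
(* Four quarters of [e]: one for each vertical move [a * s], one for the slack, one for the
   interpolation once the distance is below [e / 4 / G]. *)
have s0 : 0 < e / 4 / a by rewrite divr_gt0.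
have [G G0 HG] := reachable_estimate s0 e40.
exists (e / 4 / G); first by rewrite divr_gt0.
move=> m l m0 l0; have := HG m l m0 l0.
have : 0 <= \sum_x w x * `|l x - m x|.
  by apply: sumr_ge0 => x _; rewrite mulr_ge0.
rewrite [a * _]mulrC divfK ?gt_eqF//; set S := \sum_x _ => S0.
rewrite ltr_pdivlMr// => HS; rewrite mulrC => Sd; apply: reachable_le HS => //.
  by rewrite !addr_ge0 ?(ltW e40)// mulr_ge0// ltW.
by move: Sd; move: (G * S) => GS; lra.
Qed.

Lemma reachable_exists m l : nonneg_densities m -> nonneg_densities l ->
  exists2 B, 0 < B & reach B m l.
Proof.
move=> m0 l0; have [G G0 /(_ m l m0 l0)] := reachable_estimate (@ltr01 R) (@ltr01 R).
move=> ml; eexists; last exact: ml.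
rewrite mulr1 addr_gt0// addr_gt0//.
by rewrite ltr_wpDl// mulr_ge0 ?(ltW G0)//; apply: sumr_ge0 => x _; rewrite mulr_ge0.
Qed.

End upper_bound.

(** * Lower bounds for the distance *)

Lemma is_derive_bigsum {R : realType} (I : Type) (r : seq I) (F : I -> R -> R)
    (dF : I -> R) (t : R) : (forall i, is_derive t 1 (F i) (dF i)) ->
  is_derive t 1 (fun s => \sum_(i <- r) F i s) (\sum_(i <- r) dF i).
Proof.
move=> dFi; elim: r => [|i r IH].
  under eq_fun do rewrite big_nil.
  by rewrite big_nil; exact: is_derive_cst.
under eq_fun do rewrite big_cons.
by rewrite big_cons; exact: is_deriveD.
Qed.

Section lower_bound.
Context {R : realType} {X : finType} (K : X -> X -> R) (w p : X -> R) (a b : R).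
Context (K_markov : markov_kernel K).
Context (w_gt0 : forall x, 0 < w x) (w_reversible : reversible K w).
Context (p_gt0 : forall x, 0 < p x) (p_norm1 : norm1 w p = 1).
Context (a_gt0 : 0 < a) (b_gt0 : 0 < b).
Implicit Types (m psi l : X -> R) (B : R).
Local Notation mu := (@lebesgue_measure R).

Let K_ge0 x y : 0 <= K x y. Proof. by case: K_markov. Qed.
Let K_le1 x y : K x y <= 1.
Proof.
have [_ /(_ x) <-] := K_markov; rewrite (bigD1 y)//= lerDl.
by apply: sumr_ge0 => z _.
Qed.
Let w_ge0 x : 0 <= w x. Proof. exact: ltW. Qed.

(** [2 x B <= x^2 + B^2] at [x = a |h|]. If the lagrangian integrates to at most [B ^+ 2], the
    right-hand side integrates to at most [B / a]. *)
Lemma normr_le_lagrangian B m psi h : 0 < B ->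
  `|h| <= (2 * a)^-1 * (lagrangian K w a b m psi h / B) + (2 * a)^-1 * B.
Proof.
move=> B0.
have L_ge : (a * h) ^+ 2 <= lagrangian K w a b m psi h.
  by rewrite /lagrangian exprMn lerDl mulr_ge0 ?sqr_ge0// dirichlet_ge0.
have h2 : 2 * (a * `|h|) * B <= (a * h) ^+ 2 + B ^+ 2.
  rewrite -subr_ge0 (_ : _ - _ = (a * `|h| - B) ^+ 2) ?sqr_ge0//.
  by rewrite !exprMn -(@real_normK _ h) ?num_real//; ring.
rewrite -mulrDr mulrC ler_pdivlMr ?mulr_gt0// -(ler_pM2r B0) [leRHS]mulrDl divfK ?gt_eqF//.
rewrite (_ : _ * B = 2 * (a * `|h|) * B); last by ring.
by rewrite (le_trans h2)// -expr2 lerD2r.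
Qed.

(** The same inequality on each edge at [x], weighted by the conductance [q]: the quadratic part is
    at most twice the energy, the constant part involves the total conductance at [x], which the
    mass bounds. *)
Lemma flux_le_lagrangian B m psi h x : 0 < B -> nonneg_densities m ->
  `|flux K m psi x| <= (b ^+ 2 * w x)^-1 * (lagrangian K w a b m psi h / B)
    + (\sum_y w y * m y) / w x * B.
Proof.
move=> B0 m0; set M := \sum_y _.
pose E := dirichlet K w m psi.
pose q y := edge_mean m x y * K x y * w x.
have q_ge0 y : 0 <= q y.
  by do 2 (apply: mulr_ge0; last by []); exact: logmean_ge0.
have E_ge : \sum_y (psi y - psi x) ^+ 2 * q y <= 2 * E.
  rewrite mulrA divff ?pnatr_eq0// mul1r [leRHS](bigD1 x)//=.
  rewrite (eq_bigr (fun y =>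
      (psi y - psi x) ^+ 2 * edge_mean m x y * K x y * w x)); last first.
    by move=> y _; rewrite !mulrA.
  rewrite lerDl; apply: sumr_ge0 => u _; apply: sumr_ge0 => v _.
  by do 2 (apply: mulr_ge0; last by []); apply: mulr_ge0; [exact: sqr_ge0|exact: logmean_ge0].
(* From [logmean u v <= u + v]: the [m x] part sums to [w x * m x] as rows of [K] sum to [1]; the
   [m y] part is at most [w y * m y] by detailed balance and [K <= 1]. *)
have q_sum : \sum_y q y <= 2 * M.
  apply: (@le_trans _ _ (\sum_y (w x * m x * K x y + w y * m y))).
    apply: ler_sum => y _; rewrite /q -mulrA.
    have := logmean_le (m0 x) (m0 y); rewrite -/(edge_mean m x y).
    move=> /(ler_wpM2r (mulr_ge0 (K_ge0 x y) (w_ge0 x))) /le_trans; apply.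
    rewrite mulrDl lerD//; first by rewrite (_ : m x * _ = w x * m x * K x y)//; ring.
    rewrite w_reversible (_ : m y * _ = w y * m y * K y x); last by ring.
    by rewrite ler_piMr// mulr_ge0.
  rewrite big_split /= -mulr_sumr; have [_ ->] := K_markov.
  rewrite mulr1 mulrDl mul1r lerD2r /M (bigD1 x)//= lerDl.
  by apply: sumr_ge0 => y _; rewrite mulr_ge0.
have flux_le : w x * `|flux K m psi x| <= E / B + M * B.
  rewrite -(gtr0_norm (w_gt0 x)) -normrM mulr_sumr.
  apply: le_trans (ler_norm_sum _ _ _) _.
  apply: (@le_trans _ _ (\sum_y 2^-1 * ((psi y - psi x) ^+ 2 * q y / B + q y * B))).
    apply: ler_sum => y _; set d := psi y - psi x.
    have -> : w x * (d * edge_mean m x y * K x y) = d * q y by rewrite /q; ring.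
    rewrite normrM (ger0_norm (q_ge0 y)).
    rewrite (_ : _ * (_ + _) = 2^-1 * (d ^+ 2 / B + B) * q y); last by ring.
    rewrite ler_wpM2r// -(ler_pM2r B0) -[leRHS]mulrA [in leRHS]mulrDl divfK ?gt_eqF//.
    rewrite -subr_ge0 -[d ^+ 2]real_normK ?num_real//.
    move: `|d| => z; have -> : 2^-1 * (z ^+ 2 + B * B) - z * B = 2^-1 * (z - B) ^+ 2 by field.
    by rewrite mulr_ge0 ?sqr_ge0.
  have sum_qB : \sum_y q y * B = (\sum_y q y) * B by rewrite mulr_suml.
  rewrite -mulr_sumr big_split /= -mulr_suml sum_qB mulrDr lerD//.
    by rewrite mulrA ler_pM2r ?invr_gt0// mulrC ler_pdivrMr// mulrC.
  by rewrite mulrA ler_pM2r// mulrC ler_pdivrMr// mulrC.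
have E_le : E <= lagrangian K w a b m psi h / b ^+ 2.
  rewrite ler_pdivlMr ?exprn_gt0// mulrC /lagrangian lerDr.
  by rewrite mulr_ge0 ?sqr_ge0.
rewrite -(ler_pM2l (w_gt0 x)) (le_trans flux_le)// mulrDr lerD//.
  set L := lagrangian _ _ _ _ _ _ _ in E_le *.
  rewrite (_ : w x * _ = L / b ^+ 2 / B); last by field; rewrite !gt_eqF// exprn_gt0.
  by rewrite ler_pM2r ?invr_gt0.
by rewrite le_eqVlt; apply/orP; left; apply/eqP; field; rewrite gt_eqF.
Qed.

Section curve.
Context B mut psit ht (B_gt0 : 0 < B) (curve : curve_on K p 0 1 mut psit ht).
Let L t := lagrangian K w a b (mut t) (psit t) (ht t).
Context (L_le : (\int[mu]_(t in `[0%R, 1%R]) (L t)%:E <= (B ^+ 2)%:E)%E).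

(** Over unit time [L / B] integrates to at most [B], so both terms of the derivative bound
    contribute multiples of [B]. *)
Lemma increment_le_action (f : R -> R) (alpha beta s r : R) : absolutely_continuous 0 1 f ->
  0 <= alpha -> 0 <= beta ->
  {ae mu, forall t : R, t \in `[0, 1] -> exists2 df, is_derive t 1 f df &
    `|df| <= alpha * (L t / B) + beta * B} ->
  0 <= s -> s <= r -> r <= 1 ->
  `|f r - f s| <= (alpha + beta) * B.
Proof.
move=> fAC alpha0 beta0 fdf s0 sr r1.
have mL : measurable_fun (`[0, 1] : set R) L := curve_measurable_lagrangian w a b curve.
have L_ge0 t : 0 <= L t by exact: lagrangian_ge0.
pose k t := alpha * (L t / B) + beta * B.
have k_ge0 t : 0 <= k t by rewrite addr_ge0 ?mulr_ge0 ?invr_ge0// ltW.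
have mk : measurable_fun (`[0, 1] : set R) k.
  apply: measurable_funD => //; apply: measurable_funM => //.
  by apply: measurable_funM => //; exact: measurable_cst.
have intk : (\int[mu]_(t in `[0%R, 1%R]) (k t)%:E <= ((alpha + beta) * B)%:E)%E.
  under eq_integral do rewrite /k EFinD.
  rewrite ge0_integralD//=.
  - rewrite integral_cst//= lebesgue_measure_itv/= lte01 sube0 mule1.
    rewrite mulrDl EFinD leeD2r//.
    under eq_integral do rewrite mulrA mulrAC EFinM.
    rewrite ge0_integralZl//.
    + apply: (@le_trans _ _ ((alpha / B)%:E * (B ^+ 2)%:E)%E).
        by rewrite lee_wpmul2l// lee_fin divr_ge0// ltW.
      by rewrite -EFinM lee_fin expr2 mulrA divfK ?gt_eqF.
    + exact/measurable_EFinP.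
    + by move=> t _; rewrite lee_fin.
    + by rewrite lee_fin divr_ge0// ltW.
  - by move=> t _; rewrite lee_fin mulr_ge0// divr_ge0// ltW.
  - apply/measurable_EFinP; apply: measurable_funM => //.
    by apply: measurable_funM => //; exact: measurable_cst.
  - by move=> t _; rewrite lee_fin mulr_ge0// ltW.
have ik : mu.-integrable `[0, 1] (EFin \o k).
  apply/integrableP; split; first exact/measurable_EFinP.
  under eq_integral do rewrite /= ger0_norm//.
  exact: le_lt_trans intk (ltry _).
have := @absolutely_continuous_increment_le _ 0 1 f (k \_ `[0, 1]) s r fAC.
rewrite -Rintegral_mkcond => H.
apply: (@le_trans _ _ (\int[mu]_(t in `[0, 1]) k t)).
  apply: H => //.
  - rewrite -restrict_EFin.
    have mI : measurable (`[0, 1]%classic : set (measurableTypeR R)) by [].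
    exact: ((integrable_mkcond _ mI).1 ik).
  - by move=> t; rewrite patchE; case: ifP.
  - apply: filterS fdf; first exact: (ae_filter_ringOfSetsType mu).
    move=> t /[swap] t01 /(_ t01) [df ? ?]; exists df => //.
    by rewrite patchE ifT// inE.
rewrite -lee_fin /Rintegral fineK//.
exact: integrable_fin_num.
Qed.

(** The flux has weighted sum zero and [p] has weighted sum [1], so the mass has derivative exactly
    [ht]. *)
Lemma curve_mass_le (t : R) : t \in `[0, 1] ->
  \sum_x w x * mut t x <= \sum_x w x * mut 0 x + B / a.
Proof.
rewrite in_itv/= => /andP[t0 t1].
have := @increment_le_action (fun t => \sum_x w x * mut t x) (2 * a)^-1 (2 * a)^-1 0 t.
have a20 : 0 <= (2 * a)^-1 by rewrite invr_ge0 mulr_ge0// ltW.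
rewrite (_ : (_ + _) * B = B / a); last by field; rewrite gt_eqF.
move=> H; rewrite -lerBlDl (le_trans (ler_norm _))// H//.
  apply: absolutely_continuous_sum => x.
  by apply: absolutely_continuousM; exact: (curve_abs_cont curve x).
apply: filterS (curve_eq curve); first exact: (ae_filter_ringOfSetsType mu).
move=> s + s01 => /(_ s01) ds; exists (ht s); last exact: normr_le_lagrangian.
have -> : ht s = \sum_x w x * (ht s * p x - flux K (mut s) (psit s) x).
  under eq_bigr do rewrite mulrBr mulrCA.
  rewrite sumrB -mulr_sumr sum_weight_p// mulr1 sum_flux ?subr0//.
  exact: (curve_nonneg curve).
apply: is_derive_bigsum => x; exact: is_deriveZ.
Qed.

(** [B <= 1] bounds the mass along the curve by the initial mass plus [a^-1], so the factor of [B]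
    depends only on the starting density. *)
Lemma curve_increment_le x : B <= 1 ->
  `|mut 1 x - mut 0 x| <=
    (p x / a + (b ^+ 2 * w x)^-1 + (\sum_y w y * mut 0 y + a^-1) / w x) * B.
Proof.
move=> B1; set M := \sum_y _ + _.
have M_ge0 : 0 <= M.
  rewrite addr_ge0 ?invr_ge0 ?(ltW a_gt0)//; apply: sumr_ge0 => y _.
  rewrite mulr_ge0//; apply: (curve_nonneg curve).
  by rewrite in_itv/= lexx ler01.
have a20 : 0 <= (2 * a)^-1 by rewrite invr_ge0 mulr_ge0// ltW.
have p0 : 0 <= p x by exact: ltW.
have := @increment_le_action (fun t => mut t x)
  (p x / (2 * a) + (b ^+ 2 * w x)^-1) (p x / (2 * a) + M / w x) 0 1.
rewrite (_ : _ + _ + (_ + _) = p x / a + (b ^+ 2 * w x)^-1 + M / w x); last first.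
  by field; rewrite !gt_eqF.
apply => //.
- exact: (curve_abs_cont curve x).
- by rewrite addr_ge0 ?mulr_ge0// invr_ge0 mulr_ge0 ?sqr_ge0.
- by rewrite addr_ge0 ?mulr_ge0// invr_ge0.
apply: filterS (curve_eq curve); first exact: (ae_filter_ringOfSetsType mu).
move=> t + t01 => /(_ t01 x) dt; eexists; first exact: dt.
have h1 := normr_le_lagrangian (mut t) (psit t) (ht t) B_gt0.
have h2 := flux_le_lagrangian (psit t) (ht t) x B_gt0 (curve_nonneg curve t01).
rewrite -/(L t) in h1 h2.
rewrite (le_trans (ler_normB _ _))// normrM (gtr0_norm (p_gt0 x)).
have h3 : (\sum_y w y * mut t y) / w x * B <= M / w x * B.
  rewrite ler_pM2r// ler_pM2r ?invr_gt0// (le_trans (curve_mass_le t01))//.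
  by rewrite lerD2l ler_pdivrMr// mulVf ?gt_eqF.
have h4 := ler_wpM2r p0 h1.
apply: le_trans (lerD h4 (le_trans h2 (lerD (lexx _) h3))) _.
by rewrite le_eqVlt; apply/orP; left; apply/eqP; ring.
Qed.

End curve.
End lower_bound.

(** * Metric axioms and completeness *)

Section transport_distance.
Context {R : realType} {X : finType} (K : X -> X -> R) (w p : X -> R) (a b : R).
Context (K_markov : markov_kernel K) (K_irreducible : irreducible_kernel K).
Context (w_steady : steady_state K w) (w_reversible : reversible K w).
Context (p_gt0 : forall x, 0 < p x) (p_norm1 : norm1 w p = 1).
Context (a_gt0 : 0 < a) (b_gt0 : 0 < b).
Local Notation mu := (@lebesgue_measure R).
Local Notation M := (@nonneg_densities R X).
Local Notation reach B := (reachable K w p a b B 0 1).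
Local Notation d := (Wdist K w p a b).
Implicit Types (m l : X -> R) (B : R).

Let K_ge0 x y : 0 <= K x y. Proof. by case: K_markov. Qed.
Let w_gt0 : forall x, 0 < w x := steady_state_gt0 K_markov K_irreducible w_steady.
Let w_ge0 x : 0 <= w x. Proof. exact: ltW. Qed.

Lemma CEP m l mut psit ht : CE K p m l mut psit ht <->
  [/\ curve_on K p 0 1 mut psit ht, mut 0 = m & mut 1 = l].
Proof.
split=> [[h1 h2 h3 h4 h5 h6 h7]|[[h1 h2 h3 h4 h5] h6 h7]].
  split => //; split => //; apply: filterS h5; first exact: (ae_filter_ringOfSetsType mu).
  move=> t H t01 x; have [dt <-] := H t01 x.
  by rewrite addrK derive1E; exact/derivableP.
split => //; apply: filterS h5; first exact: (ae_filter_ringOfSetsType mu).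
move=> t H t01 x; have [dt dE] := H t01 x; split => //.
by rewrite derive1E dE subrK.
Qed.

Lemma actionE mut psit ht : curve_on K p 0 1 mut psit ht ->
  action K w a b mut psit ht =
  (\int[mu]_(t in `[0%R, 1%R]) (lagrangian K w a b (mut t) (psit t) (ht t))%:E)%E.
Proof.
move=> curve; rewrite /action.
have mh : measurable_fun (`[0, 1] : set R) (fun t => ht t ^+ 2).
  by apply: measurable_funX; exact: (curve_measurable_h curve).
have mE := curve_measurable_dirichlet w curve.
have E_ge0 t : (0 <= (dirichlet K w (mut t) (psit t))%:E)%E.
  by rewrite lee_fin dirichlet_ge0.
under [RHS]eq_integral do rewrite /lagrangian EFinD (EFinM (a ^+ 2)) (EFinM (b ^+ 2)).
rewrite ge0_integralD//; first last.
- by apply/measurable_EFinP/measurable_funM => //; exact: measurable_cst.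
- by move=> t _; rewrite -EFinM lee_fin mulr_ge0 ?sqr_ge0 ?dirichlet_ge0.
- by apply/measurable_EFinP/measurable_funM => //; exact: measurable_cst.
- by move=> t _; rewrite -EFinM lee_fin mulr_ge0 ?sqr_ge0 ?dirichlet_ge0.
rewrite !ge0_integralZl//; try (by rewrite lee_fin sqr_ge0).
- exact/measurable_EFinP.
- exact/measurable_EFinP.
- by move=> t _; rewrite lee_fin sqr_ge0.
Qed.

Let sqrte_sqrr B : 0 <= B -> sqrte (B ^+ 2)%:E = B%:E.
Proof. by move=> B0; rewrite /sqrte sqrtr_sqr ger0_norm. Qed.

Lemma reachable_Wdist_le B m l : 0 <= B -> reach B m l -> (d m l <= B%:E)%E.
Proof.
move=> B0 [mut [psit [ht [curve m0 l1]]]]; rewrite subr0 divr1 => IB.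
rewrite -(sqrte_sqrr B0) /Wdist lee_sqrt ?lee_fin ?sqr_ge0//.
apply: ereal_inf_le; exists (action K w a b mut psit ht); last by rewrite actionE.
by exists mut, psit, ht; split => //; apply/CEP.
Qed.

(** Strictness is what yields a curve: an infimum below [B ^+ 2] is undercut by some admissible
    action, whether or not it is attained. *)
Lemma Wdist_lt_reachable B m l : 0 <= B -> (d m l < B%:E)%E -> reach B m l.
Proof.
move=> B0 dB; have : (ereal_inf [set A | exists mut psit ht,
    CE K p m l mut psit ht /\ A = action K w a b mut psit ht] < (B ^+ 2)%:E)%E.
  rewrite ltNge; apply/negP => B2; move: dB; rewrite ltNge => /negP; apply.
  rewrite -(sqrte_sqrr B0) lee_sqrt//; apply: le_trans B2.
  by rewrite lee_fin sqr_ge0.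
move=> /ereal_inf_lt [_ [mut [psit [ht [/CEP[curve m0 l1] ->]]]]].
rewrite actionE// => /ltW IB; exists mut, psit, ht; split => //.
by rewrite subr0 divr1.
Qed.

Lemma Wdist_ge0 m l : (0 <= d m l)%E.
Proof. exact: sqrte_ge0. Qed.

Lemma Wdist_lty m l : M m -> M l -> (d m l < +oo)%E.
Proof.
move=> m0 l0; have [B B0 ml] := reachable_exists b K_markov K_irreducible w_steady
  w_reversible p_gt0 p_norm1 a_gt0 m0 l0.
exact: le_lt_trans (reachable_Wdist_le (ltW B0) ml) (ltry _).
Qed.

Lemma Wdist_fin m l : M m -> M l -> exists2 r, 0 <= r & d m l = r%:E.
Proof.
move=> m0 l0; exists (fine (d m l)); first by rewrite fine_ge0// Wdist_ge0.
by rewrite fineK// ge0_fin_numE ?Wdist_ge0// Wdist_lty.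
Qed.

Lemma Wdist_refl m : M m -> d m m = 0%E.
Proof.
move=> m0; apply/eqP; rewrite eq_le Wdist_ge0 andbT.
apply: reachable_Wdist_le => //.
have := reachable_raise a b K_markov w_steady p_gt0 m0 (lexx 0).
rewrite mulr0; congr (reachable _ _ _ _ _ _ _ _ _ _).
by apply/funext => x; rewrite mul0r addr0.
Qed.

Lemma Wdist_le_sym m l : M m -> M l -> (d l m <= d m l)%E.
Proof.
move=> m0 l0; have [r r0 rE] := Wdist_fin m0 l0; apply/lee_addgt0Pr => e e0.
have re0 : 0 <= r + e by rewrite addr_ge0// ltW.
rewrite rE -EFinD; apply: reachable_Wdist_le => //.
apply: reachable_sym => //; apply: Wdist_lt_reachable => //.
by rewrite rE lte_fin ltrDl.
Qed.

Lemma Wdist_triangle m1 m2 m3 : M m1 -> M m2 -> M m3 ->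
  (d m1 m3 <= d m1 m2 + d m2 m3)%E.
Proof.
move=> h1 h2 h3; have [r r0 rE] := Wdist_fin h1 h2; have [s s0 sE] := Wdist_fin h2 h3.
apply/lee_addgt0Pr => e e0; have e20 : 0 < e / 2 by rewrite divr_gt0.
(* The slack gives the strict inequality that produces a curve, and positive budgets for the
   concatenation even if a distance is [0]. *)
have re0 : 0 < r + e / 2 by rewrite ltr_wpDl.
have se0 : 0 < s + e / 2 by rewrite ltr_wpDl.
rewrite rE sE -!EFinD [e]splitr addrACA; apply: reachable_Wdist_le.
  by rewrite addr_ge0// ltW.
apply: (reachable_trans K_ge0 w_ge0 (m1 := m2)) => //; apply: Wdist_lt_reachable;
  rewrite ?ltW//; by rewrite ?rE ?sE lte_fin ltrDl.
Qed.

Lemma mass_le_Wdist m l : (d m l < 1)%E ->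
  \sum_x w x * l x <= \sum_x w x * m x + a^-1.
Proof.
move=> /(Wdist_lt_reachable ler01) [mut [psit [ht [curve <- <-]]]].
rewrite subr0 divr1 => IB.
have := curve_mass_le K_markov w_gt0 w_reversible p_gt0 p_norm1 a_gt0 ltr01 curve IB.
by move=> /(_ 1); rewrite in_itv/= lexx ler01 mul1r; exact.
Qed.

Lemma increment_le_Wdist m l B x : 0 < B -> B <= 1 -> (d m l < B%:E)%E ->
  `|l x - m x| <=
    (p x / a + (b ^+ 2 * w x)^-1 + (\sum_y w y * m y + a^-1) / w x) * B.
Proof.
move=> B0 B1 /(Wdist_lt_reachable (ltW B0)) [mut [psit [ht [curve <- <-]]]].
rewrite subr0 divr1 => IB.
exact: (curve_increment_le K_markov w_gt0 w_reversible p_gt0 p_norm1 a_gt0 b_gt0 B0 curve IB).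
Qed.

Let exists_small_multiplier (C e : R) : 0 < e -> exists B, [/\ 0 < B, B <= 1 & C * B <= e].
Proof.
move=> e0; have C10 : 0 < `|C| + 1 by rewrite ltr_wpDl.
exists (Num.min 1 (e / (`|C| + 1))); split; first by rewrite lt_min ltr01 divr_gt0.
  by rewrite ge_min lexx.
have B_ge0 : 0 <= Num.min 1 (e / (`|C| + 1)) by rewrite le_min ler01 divr_ge0// ltW.
apply: (@le_trans _ _ ((`|C| + 1) * Num.min 1 (e / (`|C| + 1)))).
  by rewrite ler_wpM2r// (le_trans (ler_norm _))// lerDl.
by rewrite mulrC -ler_pdivlMr// ge_min lexx orbT.
Qed.

Lemma Wdist_eq0 m l : M m -> M l -> d m l = 0%E -> m = l.
Proof.
move=> m0 l0 d0; apply/funext => x; apply/eqP; rewrite eq_sym -subr_eq0 -normr_le0.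
apply/ler_addgt0Pr => e e0; rewrite add0r.
set C := p x / a + (b ^+ 2 * w x)^-1 + (\sum_y w y * m y + a^-1) / w x.
have [B [B0 B1 CB]] := exists_small_multiplier C e0.
by apply: le_trans CB; apply: increment_le_Wdist; rewrite // d0 lte_fin.
Qed.

Lemma Wdist_metric : is_metric_on M d.
Proof.
split.
- by move=> m l m0 l0; rewrite Wdist_ge0 Wdist_lty.
- by move=> m l m0 l0; split => [|->]; [exact: Wdist_eq0|exact: Wdist_refl].
- by move=> m l m0 l0; apply/eqP; rewrite eq_le !Wdist_le_sym.
- exact: Wdist_triangle.
Qed.

Lemma Wdist_complete (u : nat -> X -> R) : (forall n, M (u n)) ->
  cauchy_seq d u -> exists2 l, M l & d (u n) l @[n --> \oo] --> 0%E.
Proof.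
move=> u0 u_cauchy; have [N1 HN1] := u_cauchy 1 ltr01.
(* Comparison with the single term [u N1] at distance below [1] bounds the mass of every later term,
   so the constants below do not depend on the index. *)
pose mass := \sum_y w y * u N1 y + a^-1.
have mass_u n : (N1 <= n)%N -> \sum_y w y * u n y <= mass.
  by move=> N1n; apply: mass_le_Wdist; exact: HN1.
have u_close (x : X) (e : R) : 0 < e -> exists N, forall i j, (N <= i)%N -> (N <= j)%N ->
    `|u j x - u i x| <= e.
  (* The second [a^-1] is for the mass gained along the curve from [u i] to [u j]. *)
  move=> e0; set C := p x / a + (b ^+ 2 * w x)^-1 + (mass + a^-1) / w x.
  have [B [B0 B1 CB]] := exists_small_multiplier C e0.
  have [N HN] := u_cauchy B B0; exists (maxn N1 N) => i j.
  rewrite !geq_max => /andP[N1i Ni] /andP[_ Nj].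
  apply: le_trans CB; apply: le_trans (increment_le_Wdist x B0 B1 (HN _ _ Ni Nj)) _.
  by rewrite ler_pM2r// lerD2l ler_pM2r ?invr_gt0// lerD2r mass_u.
have cvg_u x : cvgn (fun n => u n x).
  apply: R_complete; apply: cauchy_exP => e e0.
  have e20 : 0 < e / 2 by rewrite divr_gt0.
  have [N HN] := u_close x _ e20; exists (u N x); exists N => // n /= Nn.
  apply: (@le_lt_trans _ _ (e / 2)); last by rewrite ltr_pdivrMr// ltr_pMr// ltrDr.
  exact: HN.
pose l x := limn (fun n => u n x).
have l0 : M l.
  by move=> x; apply: limr_ge => //; apply: nearW => n; exact: u0.
exists l => //; have dist_u e : 0 < e -> \forall n \near \oo, (d (u n) l <= e%:E)%E.
  move=> e0; have [D D0 HD] := reachable_near b K_markov K_irreducible w_steady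
    w_reversible p_gt0 p_norm1 a_gt0 e0.
  have D20 : 0 < D / 2 by rewrite divr_gt0.
  have near_l : \forall n \near \oo, forall x, `|l x - u n x| <= D / 2.
    by apply: filter_forall => x; have /cvgrPdist_le := cvg_u x; exact.
  apply: filterS near_l => n near_l; apply: reachable_Wdist_le (ltW e0) _.
  apply: HD => //; apply: (@le_lt_trans _ _ (\sum_x w x * (D / 2))).
    by apply: ler_sum => x _; rewrite ler_wpM2l.
  rewrite -mulr_suml; have [_ -> _] := w_steady; rewrite mul1r.
  by rewrite ltr_pdivrMr// ltr_pMr// ltrDr.
apply/fine_cvgP; split.
  apply: nearW => n; have [r _ ->] := Wdist_fin (u0 n) l0; exact: fin_numE.
apply/cvgrPdist_le => e e0; apply: filterS (dist_u e e0) => n.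
have [r r0 /= ->] := Wdist_fin (u0 n) l0.
by rewrite sub0r normrN lee_fin ger0_norm.
Qed.

End transport_distance.

Theorem corollary3p11 (R : realType) (X : finType)
    (K : X -> X -> R) (w p : X -> R) (a b : R)
    (K_markov : markov_kernel K) (K_irreducible : irreducible_kernel K)
    (w_steady : steady_state K w) (w_reversible : reversible K w)
    (a_gt0 : 0 < a) (b_gt0 : 0 < b)
    (p_gt0 : forall x, 0 < p x) (p_norm1 : norm1 w p = 1) :
  complete_metric_space nonneg_densities (Wdist K w p a b).
Proof.
split; first exact: Wdist_metric.
by move=> u; exact: Wdist_complete.
Qed.
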